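(* Let $\mathcal{C}$ be a category with finite products and let $P:\mathcal{E}\to\mathcal{C}$ be a fibration. Let $\mathbf{Dial}(P)=\mathbf{Sum}(\mathbf{Prod}(P))$ be Hofstra's simple Dialectica fibration, where $\mathbf{Prod}(P)=(\mathbf{Sum}(P^{\vee}))^{\vee}$. Consider the tower of fibrations $$\mathbf{Sum}(\mathbf{Sum}(P))\xrightarrow{Q_3}\mathbf{Sum}(S)\xrightarrow{Q_2}\mathbf{S}(\mathcal{C})\xrightarrow{Q_1=S}\mathcal{C},$$ where $S:\mathbf{S}(\mathcal{C})\to\mathcal{C}$ is the simple fibration, $Q_2$ is the pullback of $S$ along $\times:\mathbf{S}(\mathcal{C})\to\mathcal{C}$, and $Q_3$ is the pullback, along the projection $\mathbf{Sum}(S)\to\mathbf{S}(\mathcal{C})$, of the fibration $\mathbf{Sum}(P)\to\mathbf{S}(\mathcal{C})$ that is the pullback of $P$ along $\times$. Then $\mathbf{Dial}(P)$ is obtained by dualizing the top two fibrations of this tower: there is an isomorphism of fibrations over $\mathcal{C}$ $$\mathbf{Dial}(P)\;\cong\;\Big(\big(\mathbf{Sum}(\mathbf{Sum}(P))\xrightarrow{Q_3}\mathbf{Sum}(S)\xrightarrow{Q_2}\mathbf{S}(\mathcal{C})\big)^{\vee_2}\xrightarrow{Q_1}\mathcal{C}\Big),$$ where $(-)^{\vee_2}$ denotes the iterated dual of a tower of height 2, and the right-hand side denotes the composite fibration from the total category of the iterated dual to $\mathcal{C}$.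
   Context: Fibrations are Grothendieck fibrations with chosen cartesian lifts. Simple fibration: $\mathbf{S}(\mathcal{C})$ has as objects pairs $(I,X)$ of objects of $\mathcal{C}$, and as morphisms $(I,X)\to(J,Y)$ pairs $(u:I\to J,\ f:I\times X\to Y)$; $S(I,X)=I$. The functor $\times:\mathbf{S}(\mathcal{C})\to\mathcal{C}$ sends $(I,X)$ to $I\times X$ and $(u,f)$ to $(i,x)\mapsto(u(i),f(i,x))$. Simple sum completion: for a fibration $P:\mathcal{E}\to\mathcal{C}$, the fibration $\mathbf{Sum}(P)$ over $\mathcal{C}$ is the composite of the pullback of $P$ along $\times:\mathbf{S}(\mathcal{C})\to\mathcal{C}$ with $S:\mathbf{S}(\mathcal{C})\to\mathcal{C}$; the same notation $\mathbf{Sum}(P)$ is used for its total category. Thus objects of $\mathbf{Sum}(P)$ are $(I,X,\alpha)$ with $\alpha$ in the fiber of $P$ over $I\times X$. In particular $\mathbf{Sum}(S)$ is the pullback of $S$ along $\times$ (with its projection $Q_2$ to the copy of $\mathbf{S}(\mathcal{C})$ mapped by $\times$, and another projection to the total category $\mathbf{S}(\mathcal{C})$ of $S$). Dual fibration: for a fibration $P:\mathcal{E}\to\mathcal{X}$, the dual $P^{\vee}=P^{\vee_{\mathcal{X}}}:\mathcal{E}^{\vee_{\mathcal{X}}}\to\mathcal{X}$ is the Grothendieck construction of the indexed category sending $X$ to the opposite of the fiber of $P$ over $X$; explicitly $\mathcal{E}^{\vee_{\mathcal{X}}}$ has the objects of $\mathcal{E}$, and morphisms $E\to D$ are pairs $(f:P(E)\to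 P(D),\ \psi:f^*D\to E)$ with $\psi$ in the fiber over $P(E)$. It is functorial on cartesian-arrow-preserving functors over $\mathcal{X}$. In $\mathbf{Prod}(P)=(\mathbf{Sum}(P^\vee))^\vee$ both duals are taken over $\mathcal{C}$. Iterated dual of a tower of height 2: given fibrations $\mathcal{E}_2\to\mathcal{E}_1\to\mathcal{E}_0$, form the dual fibration $\mathcal{E}_2^{\vee_{\mathcal{E}_1}}\to\mathcal{E}_1$ and then take duals over $\mathcal{E}_0$ of this map, viewed as a map of fibrations over $\mathcal{E}_0$, obtaining $(\mathcal{E}_2^{\vee_{\mathcal{E}_1}})^{\vee_{\mathcal{E}_0}}\to\mathcal{E}_1^{\vee_{\mathcal{E}_0}}\to\mathcal{E}_0$; the composite is a fibration over $\mathcal{E}_0$. *)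

(* Defs.v *)
From Stdlib Require Import FunctionalExtensionality ProofIrrelevance ClassicalEpsilon.

Set Implicit Arguments.
Unset Strict Implicit.
Unset Printing Implicit Defensive.

Declare Scope cat_scope.
Delimit Scope cat_scope with cat.
Open Scope cat_scope.

Record Category := {
  Ob :> Type;
  Hom : Ob -> Ob -> Type;
  idc : forall a, Hom a a;
  comp : forall a b c, Hom b c -> Hom a b -> Hom a c;
  comp_idl : forall a b (f : Hom a b), comp (idc b) f = f;
  comp_idr : forall a b (f : Hom a b), comp f (idc a) = f;
  comp_assoc : forall a b c d (h : Hom c d) (g : Hom b c) (f : Hom a b),
    comp h (comp g f) = comp (comp h g) f
}.

Arguments Hom {c0} a b : rename.
Arguments idc {c0} a : rename.
Arguments comp {c0 a b c} g f : rename.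

Notation "g ∘ f" := (comp g f) (at level 40, left associativity) : cat_scope.

Record Functor (C D : Category) := {
  fob :> C -> D;
  fmap : forall a b, Hom a b -> Hom (fob a) (fob b);
  fmap_id : forall a, fmap (idc a) = idc (fob a);
  fmap_comp : forall a b c (g : Hom b c) (f : Hom a b),
    fmap (g ∘ f) = fmap g ∘ fmap f
}.

Arguments fmap {C D} F {a b} f : rename.
Arguments fmap_id {C D} F a : rename.
Arguments fmap_comp {C D} F {a b c} g f : rename.

Definition functor_id (C : Category) : Functor C C :=
  {| fob := fun a : C => a;
     fmap := fun a b f => f;
     fmap_id := fun a => eq_refl;
     fmap_comp := fun a b c g f => eq_refl |}.

Lemma functor_comp_id C D E (G : Functor D E) (F : Functor C D) (a : C) :
  fmap G (fmap F (idc a)) = idc (G (F a)).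
Proof. now rewrite !fmap_id. Qed.

Lemma functor_comp_comp C D E (G : Functor D E) (F : Functor C D) (a b c : C)
    (g : Hom b c) (f : Hom a b) :
  fmap G (fmap F (g ∘ f)) = fmap G (fmap F g) ∘ fmap G (fmap F f).
Proof. now rewrite !fmap_comp. Qed.

Definition functor_comp C D E (G : Functor D E) (F : Functor C D) :
    Functor C E :=
  {| fob := fun a => G (F a);
     fmap := fun a b f => fmap G (fmap F f);
     fmap_id := functor_comp_id G F;
     fmap_comp := fun a b c => @functor_comp_comp C D E G F a b c |}.

(** Equality of two arrows whose endpoints are only propositionally equal.  By
    [heq_eq] it is plain equality when the endpoints coincide. *)
Inductive heq (C : Category) (a b : C) (f : Hom a b) :
    forall c d : C, Hom c d -> Prop :=
  heq_refl : heq f f.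

Arguments heq {C a b} f {c d} g : rename.

Section Heq.

Lemma heq_dom (C : Category) (a b c d : C) (f : Hom a b) (g : Hom c d) :
  heq f g -> a = c.
Proof. now destruct 1. Qed.

Lemma heq_cod (C : Category) (a b c d : C) (f : Hom a b) (g : Hom c d) :
  heq f g -> b = d.
Proof. now destruct 1. Qed.

Lemma heq_sym (C : Category) (a b c d : C) (f : Hom a b) (g : Hom c d) :
  heq f g -> heq g f.
Proof. now destruct 1. Qed.

Lemma heq_trans (C : Category) (a b c d a' b' : C) (f : Hom a b) (g : Hom c d)
    (h : Hom a' b') :
  heq f g -> heq g h -> heq f h.
Proof. now destruct 1. Qed.

Lemma heq_of_eq (C : Category) (a b : C) (f g : Hom a b) : f = g -> heq f g.
Proof. intros ->; constructor. Qed.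

Lemma heq_eq (C : Category) (a b : C) (f g : Hom a b) : heq f g -> f = g.
Proof.
  intro H.
  assert (K : existT (fun a => {b : C & Hom a b}) a (existT (fun b => Hom a b) b f)
            = existT (fun a => {b : C & Hom a b}) a (existT (fun b => Hom a b) b g)).
  { now destruct H. }
  apply inj_pair2 in K. now apply inj_pair2 in K.
Qed.

Lemma heq_comp (C : Category) (a b c a' b' c' : C) (f : Hom a b) (g : Hom b c)
    (f' : Hom a' b') (g' : Hom b' c') :
  heq f f' -> heq g g' -> heq (g ∘ f) (g' ∘ f').
Proof.
  intros Hf Hg. destruct Hf.
  pose proof (heq_cod Hg). subst c'.
  apply heq_eq in Hg. subst g'. constructor.
Qed.

Lemma heq_fmap (C D : Category) (F : Functor C D) (a b a' b' : C) (f : Hom a b)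
    (g : Hom a' b') :
  heq f g -> heq (fmap F f) (fmap F g).
Proof. now destruct 1. Qed.

Lemma functor_eq (C D : Category) (F G : Functor C D) :
  (forall a, F a = G a) ->
  (forall (a b : C) (f : Hom a b), heq (fmap F f) (fmap G f)) -> F = G.
Proof.
  destruct F as [F0 F1 F2 F3], G as [G0 G1 G2 G3]; simpl. intros H0 H1.
  assert (F0 = G0) as -> by now apply functional_extensionality.
  assert (F1 = G1) as ->.
  { do 3 (apply functional_extensionality_dep; intro). apply heq_eq, H1. }
  f_equal; apply proof_irrelevance.
Qed.

Lemma heq_idc (C : Category) (a b : C) : a = b -> heq (idc a) (idc b).
Proof. now intros ->. Qed.

End Heq.

Definition idto (C : Category) (a b : C) (p : a = b) : Hom a b :=
  match p in _ = x return Hom a x with eq_refl => idc a end.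

Lemma heq_idto_l (C : Category) (a b c : C) (p : b = c) (f : Hom a b) :
  heq (idto p ∘ f) f.
Proof. destruct p; simpl; rewrite comp_idl; constructor. Qed.

Lemma heq_idto_r (C : Category) (a b c : C) (p : c = a) (f : Hom a b) :
  heq (f ∘ idto p) f.
Proof. destruct p; simpl; rewrite comp_idr; constructor. Qed.

Definition cartesian (E B : Category) (P : Functor E B) (e' e : E)
    (m : Hom e' e) : Prop :=
  forall (d : E) (n : Hom d e) (w : Hom (P d) (P e')),
    fmap P m ∘ w = fmap P n ->
    exists! h : Hom d e', fmap P h = w /\ m ∘ h = n.

Record Fibration (E B : Category) := {
  fib :> Functor E B;
  pull : forall (b : B) (e : E), Hom b (fib e) -> E;
  lift : forall (b : B) (e : E) (u : Hom b (fib e)), Hom (pull u) e;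
  lift_over : forall (b : B) (e : E) (u : Hom b (fib e)),
    heq (fmap fib (lift u)) u;
  lift_cart : forall (b : B) (e : E) (u : Hom b (fib e)),
    cartesian fib (lift u)
}.

Arguments pull {E B} P {b} e u : rename.
Arguments lift {E B} P {b} e u : rename.
Arguments lift_over {E B} P {b} e u : rename.
Arguments lift_cart {E B} P {b} e u : rename.

Definition cartesian_functor (E E' B : Category) (P : Functor E B)
    (P' : Functor E' B) (G : Functor E E') : Prop :=
  forall (a b : E) (m : Hom a b), cartesian P m -> cartesian P' (fmap G m).

(** Isomorphism in the category of fibrations over [B] and
    cartesian-arrow-preserving functors over [B]. *)
Definition fib_iso (E E' B : Category) (P : Fibration E B)
    (P' : Fibration E' B) : Prop :=
  exists (F : Functor E E') (G : Functor E' E),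
    functor_comp P' F = P /\ functor_comp P G = P' /\
    cartesian_functor P P' F /\ cartesian_functor P' P G /\
    functor_comp G F = functor_id E /\ functor_comp F G = functor_id E'.

Section Cartesian.

Variables (E B : Category) (P : Functor E B).

Lemma cartesian_heq (a b a' b' : E) (m : Hom a b) (m' : Hom a' b') :
  heq m m' -> cartesian P m -> cartesian P m'.
Proof. now destruct 1. Qed.

Lemma hfactor_ex (b0 b1 b2 : B) (v : Hom b1 b2) (w : Hom b0 b1) (e' e d : E)
    (m : Hom e' e) (n : Hom d e) :
  cartesian P m -> heq (fmap P m) v -> heq (fmap P n) (v ∘ w) ->
  exists h : Hom d e', heq (fmap P h) w /\ m ∘ h = n.
Proof.
  intros Hm Hv Hn. destruct Hv.
  pose proof (heq_dom Hn). subst b0. apply heq_eq in Hn.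
  destruct (Hm _ n w (eq_sym Hn)) as [h [[H1 H2] _]].
  exists h. split; [now apply heq_of_eq | assumption].
Qed.

Lemma hfactor_uniq (b0 b1 : B) (w : Hom b0 b1) (e' e d : E) (m : Hom e' e)
    (h h' : Hom d e') :
  cartesian P m -> heq (fmap P h) w -> heq (fmap P h') w ->
  m ∘ h = m ∘ h' -> h = h'.
Proof.
  intros Hm H1 H2 H.
  assert (K : fmap P h' = fmap P h).
  { apply heq_eq. eapply heq_trans; [exact H2 | now apply heq_sym]. }
  destruct (Hm _ (m ∘ h) (fmap P h)) as [x [_ Hx]].
  { now rewrite fmap_comp. }
  rewrite <- (Hx h), <- (Hx h'); auto.
Qed.

(** The factorization of [n], lying over [v ∘ w], through a cartesian [m] lying
    over [v]. *)
Definition hfactor (b0 b1 b2 : B) (v : Hom b1 b2) (w : Hom b0 b1) (e' e d : E)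
    (m : Hom e' e) (n : Hom d e) (Hm : cartesian P m) (Hv : heq (fmap P m) v)
    (Hn : heq (fmap P n) (v ∘ w)) : Hom d e' :=
  proj1_sig (constructive_indefinite_description _ (hfactor_ex Hm Hv Hn)).

Section HfactorSpec.
Variables (b0 b1 b2 : B) (v : Hom b1 b2) (w : Hom b0 b1) (e' e d : E).
Variables (m : Hom e' e) (n : Hom d e) (Hm : cartesian P m).
Variables (Hv : heq (fmap P m) v) (Hn : heq (fmap P n) (v ∘ w)).

Lemma hfactor_over : heq (fmap P (hfactor Hm Hv Hn)) w.
Proof.
  unfold hfactor. destruct constructive_indefinite_description; simpl. tauto.
Qed.

Lemma hfactor_eq : m ∘ hfactor Hm Hv Hn = n.
Proof.
  unfold hfactor. destruct constructive_indefinite_description; simpl. tauto.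
Qed.

End HfactorSpec.

Lemma over_comp (a b c : E) (x y z : B) (f : Hom a b) (g : Hom b c)
    (u : Hom x y) (v : Hom y z) :
  heq (fmap P f) u -> heq (fmap P g) v -> heq (fmap P (g ∘ f)) (v ∘ u).
Proof. rewrite fmap_comp. apply heq_comp. Qed.

Lemma over_vert_l (a b c : E) (x y z : B) (f : Hom a b) (g : Hom b c)
    (u : Hom x y) :
  heq (fmap P f) u -> heq (fmap P g) (idc z) -> heq (fmap P (g ∘ f)) u.
Proof.
  intros Hf Hg.
  assert (y = z) as <-.
  { rewrite <- (heq_cod Hf). now apply heq_dom in Hg. }
  rewrite <- (comp_idl u). now apply over_comp.
Qed.

Lemma over_vert_r (a b c : E) (x y z : B) (f : Hom a b) (g : Hom b c)
    (u : Hom x y) :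
  heq (fmap P f) (idc z) -> heq (fmap P g) u -> heq (fmap P (g ∘ f)) u.
Proof.
  intros Hf Hg.
  assert (x = z) as <-.
  { rewrite <- (heq_dom Hg). now apply heq_cod in Hf. }
  rewrite <- (comp_idr u). now apply over_comp.
Qed.

Lemma over_id (a : E) (x : B) : P a = x -> heq (fmap P (idc a)) (idc x).
Proof. rewrite fmap_id. apply heq_idc. Qed.

End Cartesian.

Lemma heq_id_r (C : Category) (a b x y : C) (f : Hom a b) (g : Hom x y) :
  heq f g -> heq f (g ∘ idc x).
Proof. now rewrite comp_idr. Qed.

Lemma heq_id_l (C : Category) (a b x y : C) (f : Hom a b) (g : Hom x y) :
  heq f g -> heq f (idc y ∘ g).
Proof. now rewrite comp_idl. Qed.

Section FibComp.

Variables (E D B : Category).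

Lemma cartesian_comp (Q : Functor D B) (P : Functor E D) (a b : E)
    (m : Hom a b) :
  cartesian P m -> cartesian Q (fmap P m) -> cartesian (functor_comp Q P) m.
Proof.
  intros Hm Hq d n w H.
  destruct (Hq (P d) (fmap P n) w H) as [k [[Hk1 Hk2] Hk]].
  destruct (Hm d n k Hk2) as [h [[Hh1 Hh2] Hh]].
  exists h. split.
  - split; [simpl; now rewrite Hh1 | assumption].
  - intros h' [H1 H2]. apply Hh. split; [| assumption].
    symmetry. apply Hk. split; [exact H1 |].
    rewrite <- fmap_comp. now rewrite H2.
Qed.

Variables (Q : Fibration D B) (P : Fibration E D).

Lemma fib_comp_over (b : B) (e : E) (u : Hom b (Q (P e))) :
  heq (fmap (functor_comp Q P) (lift P e (lift Q (P e) u))) u.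
Proof.
  eapply heq_trans; [| exact (lift_over Q (P e) u)].
  simpl. apply heq_fmap. apply lift_over.
Qed.

Lemma fib_comp_cart (b : B) (e : E) (u : Hom b (Q (P e))) :
  cartesian (functor_comp Q P) (lift P e (lift Q (P e) u)).
Proof.
  apply cartesian_comp; [apply lift_cart |].
  eapply cartesian_heq; [apply heq_sym, lift_over | apply lift_cart].
Qed.

Definition fib_comp : Fibration E B :=
  {| fib := functor_comp Q P;
     pull := fun b e u => pull P e (lift Q (P e) u);
     lift := fun b e u => lift P e (lift Q (P e) u);
     lift_over := fib_comp_over;
     lift_cart := fib_comp_cart |}.

(** [P], viewed as a map of fibrations over [B]. *)
Lemma fib_comp_cartesian_functor : cartesian_functor fib_comp Q P.
Proof.
  intros a b m Hm.
  set (u := fmap (functor_comp Q P) m).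
  set (l := lift fib_comp b u).
  assert (Hl : heq (fmap (functor_comp Q P) l) u) by exact (lift_over fib_comp b u).
  assert (Cl : cartesian Q (fmap P l)).
  { eapply cartesian_heq; [apply heq_sym; exact (lift_over P b (lift Q (P b) u)) | apply lift_cart]. }
  destruct (hfactor_ex (w := idc _) (lift_cart fib_comp b u) Hl
              (n := m)) as [h [Hh1 Hh2]].
  { apply heq_id_r. constructor. }
  change (l ∘ h = m) in Hh2.
  destruct (hfactor_ex (w := idc _) Hm (heq_refl u) (n := l)) as [k [Hk1 Hk2]].
  { apply heq_id_r. exact Hl. }
  assert (Hkh : k ∘ h = idc a).
  { eapply (hfactor_uniq (P := functor_comp Q P) (w := idc _) Hm).
    - eapply (over_vert_l (P := functor_comp Q P)); [exact Hh1 | exact Hk1].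
    - apply (over_id (P := functor_comp Q P)). reflexivity.
    - rewrite comp_assoc, Hk2, comp_idr. exact Hh2. }
  intros d n w H.
  assert (Hq : fmap Q (fmap P h) ∘ fmap Q (fmap P k) = idc _).
  { rewrite <- !fmap_comp.
    assert (Hhk : h ∘ k = idc _).
    { eapply (hfactor_uniq (P := functor_comp Q P) (w := idc _)
               (lift_cart fib_comp b u)).
      - eapply (over_vert_l (P := functor_comp Q P)); [exact Hk1 | exact Hh1].
      - apply (over_id (P := functor_comp Q P)). exact (heq_dom Hl).
      - rewrite comp_assoc, comp_idr. change (l ∘ h ∘ k = l). now rewrite Hh2. }
    rewrite Hhk. now rewrite !fmap_id. }
  assert (Hq' : fmap Q (fmap P k) ∘ fmap Q (fmap P h) = idc _).
  { rewrite <- !fmap_comp, Hkh. now rewrite !fmap_id. }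
  destruct (Cl d n (fmap Q (fmap P h) ∘ w)) as [x [[Hx1 Hx2] Hx]].
  { rewrite comp_assoc, <- fmap_comp, <- fmap_comp.
    rewrite Hh2. exact H. }
  exists (fmap P k ∘ x). split.
  - split.
    + rewrite fmap_comp, Hx1, comp_assoc, Hq'. apply comp_idl.
    + rewrite comp_assoc, <- fmap_comp, Hk2. exact Hx2.
  - intros y [Hy1 Hy2].
    rewrite (Hx (fmap P h ∘ y)).
    + rewrite comp_assoc, <- fmap_comp, Hkh, fmap_id. apply comp_idl.
    + split.
      * now rewrite fmap_comp, Hy1.
      * rewrite comp_assoc, <- fmap_comp. now rewrite Hh2.
Qed.

End FibComp.

Section Pullback.

Variables (E X B : Category) (P : Functor E B) (F : Functor X B).

Record PbOb := {
  pb_base : X;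
  pb_tot : E;
  pb_ob_eq : F pb_base = P pb_tot
}.

Record PbHom (s t : PbOb) := {
  pbh_base : Hom (pb_base s) (pb_base t);
  pbh_tot : Hom (pb_tot s) (pb_tot t);
  pbh_eq : heq (fmap F pbh_base) (fmap P pbh_tot)
}.

Lemma PbHom_eq (s t : PbOb) (f g : PbHom s t) :
  pbh_base f = pbh_base g -> pbh_tot f = pbh_tot g -> f = g.
Proof.
  destruct f as [f1 f2 f3], g as [g1 g2 g3]; simpl; intros -> ->.
  f_equal. apply proof_irrelevance.
Qed.

Lemma PbHom_id_eq (s : PbOb) :
  heq (fmap F (idc (pb_base s))) (fmap P (idc (pb_tot s))).
Proof. rewrite !fmap_id. apply heq_idc, pb_ob_eq. Qed.

Definition PbHom_id (s : PbOb) : PbHom s s :=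
  {| pbh_base := idc _; pbh_tot := idc _; pbh_eq := PbHom_id_eq s |}.

Lemma PbHom_comp_eq (r s t : PbOb) (g : PbHom s t) (f : PbHom r s) :
  heq (fmap F (pbh_base g ∘ pbh_base f)) (fmap P (pbh_tot g ∘ pbh_tot f)).
Proof. rewrite !fmap_comp. apply heq_comp; apply pbh_eq. Qed.

Definition PbHom_comp (r s t : PbOb) (g : PbHom s t) (f : PbHom r s) :
    PbHom r t :=
  {| pbh_base := pbh_base g ∘ pbh_base f;
     pbh_tot := pbh_tot g ∘ pbh_tot f;
     pbh_eq := PbHom_comp_eq g f |}.

Definition Pb : Category.
Proof.
  refine {| Ob := PbOb; Hom := PbHom; idc := PbHom_id; comp := PbHom_comp |}.
  - abstract (intros; apply PbHom_eq; apply comp_idl).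
  - abstract (intros; apply PbHom_eq; apply comp_idr).
  - abstract (intros; apply PbHom_eq; apply comp_assoc).
Defined.

Definition pb_proj_base : Functor Pb X :=
  {| fob := pb_base : Pb -> X;
     fmap := pbh_base : forall a b : Pb, Hom a b -> _;
     fmap_id := fun a => eq_refl;
     fmap_comp := fun a b c g f => eq_refl |}.

Definition pb_proj_tot : Functor Pb E :=
  {| fob := pb_tot : Pb -> E;
     fmap := pbh_tot : forall a b : Pb, Hom a b -> _;
     fmap_id := fun a => eq_refl;
     fmap_comp := fun a b c g f => eq_refl |}.

Lemma pb_cartesian (s t : Pb) (m : Hom s t) :
  cartesian P (pbh_tot m) -> cartesian pb_proj_base m.
Proof.
  intros Hm d n w H. simpl in *.
  destruct (hfactor_ex (w := fmap F w) Hm (heq_sym (pbh_eq m))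
              (n := pbh_tot n)) as [h [Hh1 Hh2]].
  { rewrite <- fmap_comp, H. apply heq_sym, pbh_eq. }
  exists {| pbh_base := w; pbh_tot := h; pbh_eq := heq_sym Hh1 |}. split.
  - split; [reflexivity |]. now apply PbHom_eq.
  - intros h' [H1 H2]. apply PbHom_eq; simpl.
    + now rewrite H1.
    + eapply hfactor_uniq; [exact Hm | exact Hh1 | |].
      * rewrite <- H1. apply heq_sym, pbh_eq.
      * rewrite Hh2, <- H2. reflexivity.
Qed.

End Pullback.

Section PullbackFibration.

Variables (E X B : Category) (P : Fibration E B) (F : Functor X B).

Definition pb_lift_base (x : X) (t : Pb P F) (u : Hom x (pb_base t)) :
    Hom (F x) (P (pb_tot t)) :=
  idto (pb_ob_eq t) ∘ fmap F u.

Lemma pb_lift_eq (x : X) (t : Pb P F) (u : Hom x (pb_base t)) :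
  heq (fmap F u) (fmap P (lift P (pb_tot t) (pb_lift_base u))).
Proof.
  apply heq_sym. eapply heq_trans; [apply lift_over | apply heq_idto_l].
Qed.

Definition pb_pull (x : X) (t : Pb P F) (u : Hom x (pb_base t)) : Pb P F :=
  {| pb_base := x;
     pb_tot := pull P (pb_tot t) (pb_lift_base u);
     pb_ob_eq := heq_dom (pb_lift_eq u) |}.

Definition pb_lift (x : X) (t : Pb P F) (u : Hom x (pb_base t)) :
    @Hom (Pb P F) (pb_pull u) t :=
  @Build_PbHom E X B P F (pb_pull u) t u
    (lift P (pb_tot t) (pb_lift_base u)) (pb_lift_eq u).

Lemma pb_lift_cart (x : X) (t : Pb P F) (u : Hom x (pb_base t)) :
  cartesian (pb_proj_base P F) (pb_lift u).
Proof. apply pb_cartesian. apply lift_cart. Qed.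

Definition pb_fib : Fibration (Pb P F) X :=
  {| fib := pb_proj_base P F;
     pull := pb_pull;
     lift := pb_lift;
     lift_over := fun x t u => heq_refl u;
     lift_cart := pb_lift_cart |}.

End PullbackFibration.

Section Dual.

Variables (E B : Category) (P : Fibration E B).

(** [dh_fib] is vertical; [P (pull P d dh_base)] is only propositionally equal
    to [P e], hence the use of [heq]. *)
Record DualHom (e d : E) := {
  dh_base : Hom (P e) (P d);
  dh_fib : Hom (pull P d dh_base) e;
  dh_vert : heq (fmap P dh_fib) (idc (P e))
}.

Lemma DualHom_eq (e d : E) (f g : DualHom e d) :
  dh_base f = dh_base g -> heq (dh_fib f) (dh_fib g) -> f = g.
Proof.
  destruct f as [f1 f2 f3], g as [g1 g2 g3]; simpl.
  intros H. destruct H. intro H. apply heq_eq in H. destruct H.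
  f_equal. apply proof_irrelevance.
Qed.

Definition dual_id (e : E) : DualHom e e :=
  {| dh_base := idc (P e);
     dh_fib := lift P e (idc (P e));
     dh_vert := lift_over P e (idc (P e)) |}.

Section DualComp.

Variables (e d c : E) (g : DualHom d c) (f : DualHom e d).

(** The canonical arrow (gf)^*c -> g^*c over f. *)
Definition dual_comp_top :
    Hom (pull P c (dh_base g ∘ dh_base f)) (pull P c (dh_base g)) :=
  hfactor (lift_cart P c (dh_base g)) (lift_over P c (dh_base g))
    (lift_over P c (dh_base g ∘ dh_base f)).

Lemma dual_comp_mid_over :
  heq (fmap P (dh_fib g ∘ dual_comp_top)) (dh_base f ∘ idc (P e)).
Proof.
  apply heq_id_r. eapply over_vert_l; [apply hfactor_over | apply dh_vert].
Qed.

(** The composite of (gf)^*c = f^*g^*c with f^* applied to the vertical part of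
    [g]. *)
Definition dual_comp_mid :
    Hom (pull P c (dh_base g ∘ dh_base f)) (pull P d (dh_base f)) :=
  hfactor (lift_cart P d (dh_base f)) (lift_over P d (dh_base f))
    dual_comp_mid_over.

Lemma dual_comp_vert : heq (fmap P (dh_fib f ∘ dual_comp_mid)) (idc (P e)).
Proof. eapply over_vert_l; [apply hfactor_over | apply dh_vert]. Qed.

Definition dual_comp : DualHom e c :=
  {| dh_base := dh_base g ∘ dh_base f;
     dh_fib := dh_fib f ∘ dual_comp_mid;
     dh_vert := dual_comp_vert |}.

End DualComp.

Definition dual_comp_rel (e d c : E) (g : DualHom d c) (f : DualHom e d)
    (k : DualHom e c) : Prop :=
  dh_base k = dh_base g ∘ dh_base f /\
  exists (t : Hom (pull P c (dh_base k)) (pull P c (dh_base g)))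
         (s : Hom (pull P c (dh_base k)) (pull P d (dh_base f))),
    heq (fmap P t) (dh_base f) /\
    lift P c (dh_base g) ∘ t = lift P c (dh_base k) /\
    heq (fmap P s) (idc (P e)) /\
    lift P d (dh_base f) ∘ s = dh_fib g ∘ t /\
    dh_fib k = dh_fib f ∘ s.

Lemma dual_comp_spec (e d c : E) (g : DualHom d c) (f : DualHom e d) :
  dual_comp_rel g f (dual_comp g f).
Proof.
  split; [reflexivity |].
  exists (dual_comp_top g f), (dual_comp_mid g f). repeat split.
  - apply hfactor_over.
  - apply hfactor_eq.
  - apply hfactor_over.
  - apply hfactor_eq.
Qed.

Lemma dual_comp_uniq (e d c : E) (g : DualHom d c) (f : DualHom e d)
    (k : DualHom e c) :
  dual_comp_rel g f k -> dual_comp g f = k.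
Proof.
  destruct k as [kb kf kv].
  intros [Hb [t [s [Ht [Et [Hs [Es Ek]]]]]]]. simpl in *. subst kb.
  apply DualHom_eq; simpl; [reflexivity |].
  rewrite Ek. apply heq_of_eq. f_equal.
  eapply hfactor_uniq;
    [apply lift_cart | apply hfactor_over | exact Hs |].
  rewrite Es. unfold dual_comp_mid. rewrite hfactor_eq. f_equal.
  eapply hfactor_uniq;
    [apply lift_cart | apply hfactor_over | exact Ht |].
  rewrite Et. apply hfactor_eq.
Qed.

Lemma dual_idl (e d : E) (f : DualHom e d) : dual_comp (dual_id d) f = f.
Proof.
  apply dual_comp_uniq. split; [simpl; now rewrite comp_idl |].
  destruct (hfactor_ex (w := dh_base f) (lift_cart P d (idc (P d)))
    (lift_over P d _) (n := lift P d (dh_base f))) as [t [Ht Et]].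
  { apply heq_id_l, lift_over. }
  exists t, (idc _). repeat split; auto.
  - apply over_id. exact (heq_dom (lift_over P d (dh_base f))).
  - simpl. rewrite Et. apply comp_idr.
  - now rewrite comp_idr.
Qed.

Lemma dual_idr (e d : E) (f : DualHom e d) : dual_comp f (dual_id e) = f.
Proof.
  apply dual_comp_uniq. split; [simpl; now rewrite comp_idr |].
  assert (Hd := heq_dom (lift_over P d (dh_base f))).
  destruct (hfactor_ex (w := idc (P e)) (lift_cart P e (idc (P e)))
    (lift_over P e _) (n := dh_fib f)) as [s [Hs Es]].
  { apply heq_id_r, dh_vert. }
  exists (idc _), s. repeat split; auto.
  - simpl. now apply over_id.
  - apply comp_idr.
  - simpl. rewrite Es. now rewrite comp_idr.
Qed.

Lemma dual_assoc (a b c d : E) (h : DualHom c d) (g : DualHom b c)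
    (f : DualHom a b) :
  dual_comp h (dual_comp g f) = dual_comp (dual_comp h g) f.
Proof.
  apply dual_comp_uniq. split; [simpl; now rewrite comp_assoc |].
  destruct (dual_comp_spec h g) as [_ [k1 [p [Hk1 [Ek1 [Hp [Ep E1]]]]]]].
  destruct (dual_comp_spec (dual_comp h g) f)
    as [_ [k2 [q [Hk2 [Ek2 [Hq [Eq E2]]]]]]].
  destruct (dual_comp_spec g f) as [_ [k3 [r [Hk3 [Ek3 [Hr [Er E3]]]]]]].
  assert (Hk4 : heq (fmap P (k1 ∘ k2)) (dh_base (dual_comp g f))).
  { simpl. now apply over_comp. }
  assert (Ek4 : lift P d (dh_base h) ∘ (k1 ∘ k2)
              = lift P d (dh_base (dual_comp (dual_comp h g) f))).
  { now rewrite comp_assoc, Ek1. }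
  destruct (hfactor_ex (w := idc (P a))
    (lift_cart P c (dh_base (dual_comp g f)))
    (lift_over P c _) (n := dh_fib h ∘ (k1 ∘ k2))) as [s [Hs Es]].
  { apply heq_id_r. eapply over_vert_l; [exact Hk4 | apply dh_vert]. }
  exists (k1 ∘ k2), s. repeat split; auto.
  rewrite E2, E3, <- comp_assoc. f_equal.
  eapply hfactor_uniq; [apply lift_cart | exact Hq | |].
  - eapply over_vert_l; [exact Hs | exact Hr].
  - rewrite Eq, E1, comp_assoc, Er, <- !comp_assoc. f_equal.
    eapply hfactor_uniq; [apply lift_cart | | |].
    + eapply over_vert_l; [exact Hk2 | exact Hp].
    + eapply over_vert_r; [exact Hs | exact Hk3].
    + rewrite comp_assoc, Ep, comp_assoc, Ek3, Es. now rewrite comp_assoc.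
Qed.

Definition Dual : Category :=
  {| Ob := E;
     Hom := DualHom;
     idc := dual_id;
     comp := dual_comp;
     comp_idl := dual_idl;
     comp_idr := dual_idr;
     comp_assoc := dual_assoc |}.

Definition dual_proj : Functor Dual B :=
  {| fob := (fun e => P e) : Dual -> B;
     fmap := dh_base : forall a b : Dual, Hom a b -> _;
     fmap_id := fun e => eq_refl;
     fmap_comp := fun a b c g f => eq_refl |}.

Lemma dual_cartesian (e' e : Dual) (m : Hom e' e)
    (i : Hom (e' : E) (pull P (e : E) (dh_base m))) :
  dh_fib m ∘ i = idc _ -> i ∘ dh_fib m = idc _ -> cartesian dual_proj m.
Proof.
  intros Hi1 Hi2 d n w H. simpl in *.
  assert (Hi : heq (fmap P i) (idc (P e'))).
  { assert (K : fmap P (dh_fib m) ∘ fmap P i = idc _)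
      by now rewrite <- fmap_comp, Hi1, fmap_id.
    assert (L : heq (fmap P (dh_fib m) ∘ fmap P i) (fmap P i)).
    { pose proof (dh_vert m) as V. revert V K.
      generalize (fmap P (dh_fib m)) (fmap P i).
      generalize (P (pull P (e : E) (dh_base m))).
      intros x f g V _. pose proof (heq_dom V). subst x.
      apply heq_eq in V. rewrite V, comp_idl. constructor. }
    eapply heq_trans; [apply heq_sym, L |]. rewrite K. constructor. }
  destruct (hfactor_ex (w := w) (lift_cart P e (dh_base m))
    (lift_over P e (dh_base m)) (n := lift P e (dh_base n))) as [k [Hk Ek]].
  { rewrite H. apply lift_over. }
  destruct (hfactor_ex (w := idc _) (lift_cart P e' w)
    (lift_over P e' w) (n := dh_fib m ∘ k)) as [s [Hs Es]].
  { apply heq_id_r. eapply over_vert_l; [exact Hk | apply dh_vert]. }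
  destruct (hfactor_ex (w := idc _) (lift_cart P e (dh_base n))
    (lift_over P e (dh_base n)) (n := lift P e (dh_base m) ∘ (i ∘ lift P e' w)))
    as [t [Ht Et]].
  { apply heq_id_r. rewrite <- H. apply over_comp; [| apply lift_over].
    eapply over_vert_l; [apply lift_over | exact Hi]. }
  assert (Hkt : k ∘ t = i ∘ lift P e' w).
  { eapply hfactor_uniq; [apply (lift_cart P e (dh_base m)) | | |].
    - eapply over_vert_r; [exact Ht | exact Hk].
    - eapply over_vert_l; [apply lift_over | exact Hi].
    - now rewrite comp_assoc, Ek. }
  assert (Hst : s ∘ t = idc _).
  { eapply hfactor_uniq; [apply (lift_cart P e' w) | | |].
    - eapply over_vert_l; [exact Ht | exact Hs].
    - apply over_id. exact (heq_dom (lift_over P e' w)).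
    - rewrite comp_assoc, Es, <- comp_assoc, Hkt, comp_assoc, Hi1, comp_idl.
      now rewrite comp_idr. }
  assert (Hts : t ∘ s = idc _).
  { eapply hfactor_uniq; [apply (lift_cart P e (dh_base n)) | | |].
    - eapply over_vert_l; [exact Hs | exact Ht].
    - apply over_id. exact (heq_dom (lift_over P e (dh_base n))).
    - rewrite comp_assoc, Et, <- !comp_assoc, Es, (comp_assoc i), Hi2, comp_idl.
      now rewrite Ek, comp_idr. }
  assert (Hh : heq (fmap P (dh_fib n ∘ t)) (idc (P d))).
  { eapply over_vert_l; [exact Ht | apply dh_vert]. }
  exists (@Build_DualHom d e' w (dh_fib n ∘ t) Hh). split.
  - split; [reflexivity |]. apply dual_comp_uniq. split; [exact (eq_sym H) |].
    exists k, s. repeat split; auto. simpl.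
    now rewrite <- comp_assoc, Hts, comp_idr.
  - intros [w' y Hy] [H1 H2]. simpl in *. subst w'.
    apply DualHom_eq; [reflexivity |]. simpl. apply heq_of_eq.
    assert (K : dual_comp_rel m (@Build_DualHom d e' w y Hy) n).
    { rewrite <- H2. apply dual_comp_spec. }
    destruct K as [_ [k' [s' [Hk' [Ek' [Hs' [Es' Ey]]]]]]]. simpl in *.
    assert (k' = k) as ->.
    { eapply hfactor_uniq; [apply (lift_cart P e (dh_base m)) | exact Hk' | exact Hk |].
      now rewrite Ek, Ek'. }
    assert (s' = s) as ->.
    { eapply hfactor_uniq; [apply (lift_cart P e' w) | exact Hs' | exact Hs |].
      now rewrite Es, Es'. }
    now rewrite Ey, <- comp_assoc, Hst, comp_idr.
Qed.

Section DualLift.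

Variables (b : B) (e : E) (u : Hom b (P e)).

Lemma dual_lift_over :
  heq (fmap P (lift P e (fmap P (lift P e u))))
      (fmap P (lift P e u) ∘ idc _).
Proof. apply heq_id_r. apply lift_over. Qed.

(** [P (pull P e u)] is only propositionally equal to [b], so the base of the
    chosen lift is [fmap P (lift P e u)] rather than [u], and its vertical part
    is the canonical isomorphism rather than an identity. *)
Definition dual_lift : @Hom Dual (pull P e u) e :=
  @Build_DualHom (pull P e u) e (fmap P (lift P e u))
    (hfactor (lift_cart P e u) (heq_refl _) dual_lift_over)
    (hfactor_over (lift_cart P e u) (heq_refl _) dual_lift_over).

Lemma dual_lift_cart : cartesian dual_proj dual_lift.
Proof.
  destruct (hfactor_ex (w := idc _) (lift_cart P e (fmap P (lift P e u)))
    (lift_over P e _) (n := lift P e u)) as [i [Hi Ei]].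
  { apply heq_id_r. constructor. }
  apply dual_cartesian with (i := i); simpl.
  - eapply hfactor_uniq; [apply (lift_cart P e u) | | |].
    + eapply over_vert_l; [exact Hi | apply hfactor_over].
    + now apply over_id.
    + now rewrite comp_assoc, hfactor_eq, comp_idr.
  - eapply hfactor_uniq; [apply (lift_cart P e (fmap P (lift P e u))) | | |].
    + eapply over_vert_l; [apply hfactor_over | exact Hi].
    + apply over_id. exact (heq_dom (lift_over P e (fmap P (lift P e u)))).
    + now rewrite comp_assoc, Ei, hfactor_eq, comp_idr.
Qed.

End DualLift.

Definition dual : Fibration Dual B :=
  {| fib := dual_proj;
     pull := (fun b e u => pull P e u)
       : forall (b : B) (e : Dual), Hom b (dual_proj e) -> Dual;
     lift := dual_lift;
     lift_over := fun b e u => lift_over P e u;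
     lift_cart := dual_lift_cart |}.

End Dual.

Section DualMap.

Variables (E E' B : Category) (P : Fibration E B) (P' : Fibration E' B).
Variables (G : Functor E E') (GP : functor_comp P' G = P).
Variable (Gcart : cartesian_functor P P' G).

Lemma over_ob (e : E) : P' (G e) = P e.
Proof. rewrite <- GP. reflexivity. Qed.

Lemma over_hom (a b : E) (m : Hom a b) : heq (fmap P' (fmap G m)) (fmap P m).
Proof. rewrite <- GP. constructor. Qed.

Lemma over_G (a b : E) (m : Hom a b) (x y : B) (u : Hom x y) :
  heq (fmap P m) u -> heq (fmap P' (fmap G m)) u.
Proof. apply heq_trans, over_hom. Qed.

Definition dual_map_base (e d : E) (f : DualHom P e d) :
    Hom (P' (G e)) (P' (G d)) :=
  idto (eq_sym (over_ob d)) ∘ dh_base f ∘ idto (over_ob e).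

Lemma dual_map_base_heq (e d : E) (f : DualHom P e d) :
  heq (dual_map_base f) (dh_base f).
Proof.
  unfold dual_map_base.
  eapply heq_trans; [apply heq_idto_r | apply heq_idto_l].
Qed.

Lemma dual_map_lift_over (e d : E) (f : DualHom P e d) :
  heq (fmap P' (fmap G (lift P d (dh_base f)))) (dual_map_base f).
Proof.
  eapply heq_trans; [| apply heq_sym, dual_map_base_heq].
  apply over_G, lift_over.
Qed.

(** The canonical arrow f^*(G d) -> G (f^* d). *)
Definition dual_map_can (e d : E) (f : DualHom P e d) :
    Hom (pull P' (G d) (dual_map_base f)) (G (pull P d (dh_base f))) :=
  hfactor (Gcart (lift_cart P d (dh_base f))) (dual_map_lift_over f)
    (heq_id_r (lift_over P' (G d) (dual_map_base f))).

Lemma dual_map_vert (e d : E) (f : DualHom P e d) :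
  heq (fmap P' (fmap G (dh_fib f) ∘ dual_map_can f)) (idc (P' (G e))).
Proof.
  eapply over_vert_l; [apply hfactor_over |].
  apply over_G, dh_vert.
Qed.

Definition dual_map_hom (e d : E) (f : DualHom P e d) :
    DualHom P' (G e) (G d) :=
  {| dh_base := dual_map_base f;
     dh_fib := fmap G (dh_fib f) ∘ dual_map_can f;
     dh_vert := dual_map_vert f |}.

Lemma dual_map_id (e : E) : dual_map_hom (dual_id P e) = dual_id P' (G e).
Proof.
  assert (Hb : dual_map_base (dual_id P e) = idc (P' (G e))).
  { apply heq_eq. eapply heq_trans; [apply dual_map_base_heq |].
    simpl. apply heq_idc. symmetry. apply over_ob. }
  apply DualHom_eq; simpl; [exact Hb |].
  unfold dual_map_can. simpl. rewrite hfactor_eq. now rewrite Hb.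
Qed.

Lemma dual_map_comp (a b c : E) (g : DualHom P b c) (f : DualHom P a b) :
  dual_map_hom (dual_comp g f) = dual_comp (dual_map_hom g) (dual_map_hom f).
Proof.
  symmetry. apply dual_comp_uniq.
  assert (Hb : dual_map_base (dual_comp g f) = dual_map_base g ∘ dual_map_base f).
  { apply heq_eq. eapply heq_trans; [apply dual_map_base_heq |].
    apply heq_sym. apply heq_comp; apply dual_map_base_heq. }
  split; [exact Hb |].
  destruct (dual_comp_spec g f) as [_ [k [h [Hk [Ek [Hh [Eh Ef]]]]]]].
  set (gf := dual_comp g f) in *.
  destruct (hfactor_ex (w := dual_map_base f)
    (lift_cart P' (G c) (dual_map_base g)) (lift_over P' (G c) _)
    (n := lift P' (G c) (dual_map_base gf))) as [k' [Hk' Ek']].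
  { rewrite <- Hb. apply lift_over. }
  assert (HGk : heq (fmap P' (fmap G k)) (dual_map_base f)).
  { eapply heq_trans; [apply over_G, Hk | apply heq_sym, dual_map_base_heq]. }
  assert (Ec : forall (x y : E) (m : DualHom P x y),
    fmap G (lift P y (dh_base m)) ∘ dual_map_can m = lift P' (G y) (dual_map_base m)).
  { intros. apply hfactor_eq. }
  assert (Hc : forall (x y : E) (m : DualHom P x y),
    heq (fmap P' (dual_map_can m)) (idc (P' (G x)))).
  { intros. apply hfactor_over. }
  destruct (hfactor_ex (w := idc (P' (G a)))
    (lift_cart P' (G b) (dual_map_base f)) (lift_over P' (G b) _)
    (n := fmap G (dh_fib g) ∘ dual_map_can g ∘ k')) as [h' [Hh' Eh']].
  { apply heq_id_r. eapply over_vert_l; [exact Hk' | apply dual_map_vert]. }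
  exists k', h'. repeat split; auto.
  change (fmap G (dh_fib gf) ∘ dual_map_can gf
        = fmap G (dh_fib f) ∘ dual_map_can f ∘ h').
  rewrite Ef, fmap_comp, <- !comp_assoc. f_equal.
  eapply hfactor_uniq; [apply (Gcart (lift_cart P b (dh_base f))) | | |].
  - eapply over_vert_l; [apply Hc | apply over_G, Hh].
  - eapply over_vert_r; [exact Hh' | apply Hc].
  - rewrite comp_assoc, <- fmap_comp, Eh, (comp_assoc _ _ h'), Ec.
    rewrite Eh', fmap_comp, <- !comp_assoc. f_equal.
    eapply hfactor_uniq; [apply (Gcart (lift_cart P c (dh_base g))) | | |].
    + eapply over_vert_r; [apply Hc | exact HGk].
    + eapply over_vert_l; [exact Hk' | apply Hc].
    + now rewrite comp_assoc, <- fmap_comp, Ek, comp_assoc, !Ec.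
Qed.

Definition dual_map : Functor (Dual P) (Dual P') :=
  {| fob := (fun e => G e) : Dual P -> Dual P';
     fmap := dual_map_hom : forall a b : Dual P, Hom a b -> _;
     fmap_id := dual_map_id;
     fmap_comp := dual_map_comp |}.

End DualMap.

Section IteratedDual.

Variables (E2 E1 E0 : Category) (Q : Fibration E2 E1) (R : Fibration E1 E0).

Definition IteratedDual : Category := Dual (fib_comp R (dual Q)).

Definition iterated_dual_map : Functor IteratedDual (Dual R) :=
  @dual_map _ _ _ (fib_comp R (dual Q)) R (dual Q) eq_refl
    (@fib_comp_cartesian_functor _ _ _ R (dual Q)).

(** The composite of the two projections; as a functor it is also the dual of
    the composite fibration ([iterated_dual_functor_eq]), whose chosen lifts
    [iterated_dual] reuses. *)
Definition iterated_dual_functor : Functor IteratedDual E0 :=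
  functor_comp (dual R) iterated_dual_map.

Lemma iterated_dual_functor_eq :
  dual (fib_comp R (dual Q)) = iterated_dual_functor :> Functor _ _.
Proof.
  apply functor_eq; [reflexivity |].
  intros a b f. apply heq_sym.
  exact (@dual_map_base_heq _ _ _ (fib_comp R (dual Q)) R (dual Q) eq_refl a b f).
Qed.

Lemma iterated_dual_over (b : E0) (e : IteratedDual)
    (u : Hom b (iterated_dual_functor e)) :
  heq (fmap iterated_dual_functor (lift (dual (fib_comp R (dual Q))) e u)) u.
Proof.
  eapply heq_trans; [| exact (lift_over (dual (fib_comp R (dual Q))) e u)].
  exact (@dual_map_base_heq _ _ _ (fib_comp R (dual Q)) R (dual Q) eq_refl _ _
           (lift (dual (fib_comp R (dual Q))) e u)).
Qed.

Lemma iterated_dual_cart (b : E0) (e : IteratedDual)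
    (u : Hom b (iterated_dual_functor e)) :
  cartesian iterated_dual_functor (lift (dual (fib_comp R (dual Q))) e u).
Proof.
  rewrite <- iterated_dual_functor_eq.
  exact (lift_cart (dual (fib_comp R (dual Q))) e u).
Qed.

Definition iterated_dual : Fibration IteratedDual E0 :=
  {| fib := iterated_dual_functor;
     pull := fun b e u => pull (dual (fib_comp R (dual Q))) e u;
     lift := fun b e u => lift (dual (fib_comp R (dual Q))) e u;
     lift_over := iterated_dual_over;
     lift_cart := iterated_dual_cart |}.

End IteratedDual.

(** Chosen finite products: a terminal object and binary products. *)
Record FinProducts (C : Category) := {
  term : C;
  bang : forall a : C, Hom a term;
  bang_uniq : forall (a : C) (f : Hom a term), f = bang a;
  prd : C -> C -> C;
  pr1 : forall a b : C, Hom (prd a b) a;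
  pr2 : forall a b : C, Hom (prd a b) b;
  pairing : forall x a b : C, Hom x a -> Hom x b -> Hom x (prd a b);
  pairing_pr1 : forall (x a b : C) (f : Hom x a) (g : Hom x b),
    pr1 a b ∘ pairing f g = f;
  pairing_pr2 : forall (x a b : C) (f : Hom x a) (g : Hom x b),
    pr2 a b ∘ pairing f g = g;
  pairing_uniq : forall (x a b : C) (h : Hom x (prd a b)),
    h = pairing (pr1 a b ∘ h) (pr2 a b ∘ h)
}.

Arguments pr1 {C} f {a b} : rename.
Arguments pr2 {C} f {a b} : rename.
Arguments pairing {C} f {x a b} _ _ : rename.

Lemma pairing_comp (C : Category) (T : FinProducts C) (y x a b : C)
    (f : Hom x a) (g : Hom x b) (h : Hom y x) :
  pairing T f g ∘ h = pairing T (f ∘ h) (g ∘ h).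
Proof.
  rewrite (pairing_uniq (pairing T f g ∘ h)).
  now rewrite !comp_assoc, pairing_pr1, pairing_pr2.
Qed.

Lemma pairing_id (C : Category) (T : FinProducts C) (a b : C) :
  pairing T (pr1 T) (pr2 T) = idc (prd T a b).
Proof. rewrite (pairing_uniq (idc _)). now rewrite !comp_idr. Qed.

Section Simple.

Variables (C : Category) (T : FinProducts C).

Record SimpleHom (s t : C * C) := {
  sh_base : Hom (fst s) (fst t);
  sh_fib : Hom (prd T (fst s) (snd s)) (snd t)
}.

Definition simple_id (s : C * C) : SimpleHom s s :=
  {| sh_base := idc _; sh_fib := pr2 T |}.

Definition simple_comp (r s t : C * C) (g : SimpleHom s t)
    (f : SimpleHom r s) : SimpleHom r t :=
  {| sh_base := sh_base g ∘ sh_base f;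
     sh_fib := sh_fib g ∘ pairing T (sh_base f ∘ pr1 T) (sh_fib f) |}.

Lemma simple_idl (s t : C * C) (f : SimpleHom s t) :
  simple_comp (simple_id t) f = f.
Proof.
  destruct f; unfold simple_comp; simpl.
  now rewrite comp_idl, pairing_pr2.
Qed.

Lemma simple_idr (s t : C * C) (f : SimpleHom s t) :
  simple_comp f (simple_id s) = f.
Proof.
  destruct f; unfold simple_comp; simpl.
  now rewrite comp_idr, comp_idl, pairing_id, comp_idr.
Qed.

Lemma simple_assoc (q r s t : C * C) (h : SimpleHom s t) (g : SimpleHom r s)
    (f : SimpleHom q r) :
  simple_comp h (simple_comp g f) = simple_comp (simple_comp h g) f.
Proof.
  unfold simple_comp; simpl. f_equal; [apply comp_assoc |].
  rewrite <- !comp_assoc, pairing_comp, <- !comp_assoc. now rewrite pairing_pr1.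
Qed.

Definition Simple : Category :=
  {| Ob := (C * C)%type;
     Hom := SimpleHom;
     idc := simple_id;
     comp := simple_comp;
     comp_idl := simple_idl;
     comp_idr := simple_idr;
     comp_assoc := simple_assoc |}.

Definition simple_proj : Functor Simple C :=
  {| fob := fst : Simple -> C;
     fmap := sh_base : forall a b : Simple, Hom a b -> _;
     fmap_id := fun s => eq_refl;
     fmap_comp := fun r s t g f => eq_refl |}.

Definition simple_lift (I : C) (s : Simple) (u : Hom I (fst s)) :
    @Hom Simple (I, snd s) s :=
  @Build_SimpleHom (I, snd s) s u (pr2 T).

Lemma simple_lift_cart (I : C) (s : Simple) (u : Hom I (fst s)) :
  cartesian simple_proj (simple_lift u).
Proof.
  intros d n w H. simpl in *.
  exists (@Build_SimpleHom d (I, snd s) w (sh_fib n)). split.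
  - split; [reflexivity |]. destruct n; simpl in *. subst.
    unfold simple_comp; simpl. now rewrite pairing_pr2.
  - intros [x y] [H1 H2]. simpl in *. subst x n. simpl.
    now rewrite pairing_pr2.
Qed.

Definition simple_fib : Fibration Simple C :=
  {| fib := simple_proj;
     pull := (fun I s u => (I, snd s))
       : forall (I : C) (s : Simple), Hom I (simple_proj s) -> Simple;
     lift := simple_lift;
     lift_over := fun I s u => heq_refl u;
     lift_cart := simple_lift_cart |}.

Definition simple_prod_map (s t : C * C) (f : SimpleHom s t) :
    Hom (prd T (fst s) (snd s)) (prd T (fst t) (snd t)) :=
  pairing T (sh_base f ∘ pr1 T) (sh_fib f).

Lemma simple_prod_id (s : C * C) : simple_prod_map (simple_id s) = idc _.
Proof.
  unfold simple_prod_map; simpl. now rewrite comp_idl, pairing_id.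
Qed.

Lemma simple_prod_comp (r s t : C * C) (g : SimpleHom s t) (f : SimpleHom r s) :
  simple_prod_map (simple_comp g f) = simple_prod_map g ∘ simple_prod_map f.
Proof.
  unfold simple_prod_map; simpl.
  now rewrite pairing_comp, <- !comp_assoc, pairing_pr1.
Qed.

Definition simple_prod : Functor Simple C :=
  {| fob := (fun s => prd T (fst s) (snd s)) : Simple -> C;
     fmap := simple_prod_map : forall a b : Simple, Hom a b -> _;
     fmap_id := simple_prod_id;
     fmap_comp := simple_prod_comp |}.

End Simple.

Section Dialectica.

Variables (C : Category) (T : FinProducts C).

Definition SumCat (E : Category) (P : Fibration E C) : Category :=
  Pb P (simple_prod T).

Definition sum_simple (E : Category) (P : Fibration E C) :
    Fibration (SumCat P) (Simple T) :=
  pb_fib P (simple_prod T).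

Definition Sum (E : Category) (P : Fibration E C) : Fibration (SumCat P) C :=
  fib_comp (simple_fib T) (sum_simple P).

Definition Prod (E : Category) (P : Fibration E C) :
    Fibration (Dual (Sum (dual P))) C :=
  dual (Sum (dual P)).

Definition Dial (E : Category) (P : Fibration E C) :
    Fibration (SumCat (Prod P)) C :=
  Sum (Prod P).

Definition Q1 : Fibration (Simple T) C := simple_fib T.

Definition Q2 : Fibration (SumCat (simple_fib T)) (Simple T) :=
  sum_simple (simple_fib T).

(** The projection Sum(S) -> S(C) to the total category of S, which sends
    ((I, X), (I × X, Y)) to (I × X, Y). *)
Definition sum_S_proj : Functor (SumCat (simple_fib T)) (Simple T) :=
  pb_proj_tot (simple_fib T) (simple_prod T).

(** The total category is Sum(Sum(P)): up to the pasting of pullbacks, it is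
    the pullback of [Sum P] along [simple_prod]. *)
Definition Q3 (E : Category) (P : Fibration E C) :
    Fibration (Pb (sum_simple P) sum_S_proj) (SumCat (simple_fib T)) :=
  pb_fib (sum_simple P) sum_S_proj.

End Dialectica.

(* Main.v *)
From Stdlib Require Import ProofIrrelevance ClassicalEpsilon.
Require Import Defs.

Set Implicit Arguments.
Unset Strict Implicit.
Unset Printing Implicit Defensive.

(** An arrow (I, X, Y, α) -> (I', X', Y', α') of either side unwinds to the same
    data: an arrow (I, X) -> (I', X') of S(C), inducing v : I × X -> I' × X', an
    arrow g : I × X × Y' -> Y, and a vertical arrow from the reindexing of α along
    (z, y') ↦ (z, g (z, y')) to the reindexing of α' along (z, y') ↦ (v z, y').
    Composing the latter with the cartesian lifts gives a span α <- x -> α' in E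
    with cartesian left leg, determined up to vertical isomorphism of x.  On both
    sides composition of arrows is composition of spans, because an arrow of a
    dual of a dual composes in this way ([dual_dual_comp]); relating the arrows
    that have isomorphic spans is therefore an isomorphism of categories over C. *)

(** * Isomorphisms of categories over a base *)

Lemma heq_functor_eq (C D : Category) (F G : Functor C D) (a b : C)
    (f : Hom a b) :
  F = G -> heq (fmap F f) (fmap G f).
Proof. intros ->. constructor. Qed.

(** The preimage is [fmap G n], carried along the object equalities G (F x) = x. *)
Lemma iso_full (E E' : Category) (F : Functor E E') (G : Functor E' E) :
  functor_comp G F = functor_id E -> functor_comp F G = functor_id E' ->
  forall (a b : E) (n : Hom (F a) (F b)), exists m : Hom a b, fmap F m = n.
Proof.
  intros HGF HFG a b n.
  assert (Ho : forall x : E, G (F x) = x).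
  { intro x. change (functor_comp G F x = functor_id E x). now rewrite HGF. }
  exists (idto (Ho b) ∘ fmap G n ∘ idto (eq_sym (Ho a))).
  apply heq_eq. apply heq_trans with (g := fmap F (fmap G n)).
  - apply heq_fmap. eapply heq_trans; [apply heq_idto_r | apply heq_idto_l].
  - exact (heq_functor_eq n HFG).
Qed.

Lemma left_inverse_faithful (E E' : Category) (F : Functor E E')
    (G : Functor E' E) :
  functor_comp G F = functor_id E ->
  forall (a b : E) (m m' : Hom a b), fmap F m = fmap F m' -> m = m'.
Proof.
  intros HGF a b m m' H. apply heq_eq.
  eapply heq_trans; [exact (heq_sym (heq_functor_eq m HGF)) |].
  simpl. rewrite H. exact (heq_functor_eq m' HGF).
Qed.

(** Being cartesian is a property of an arrow in a category over B, hence invariant under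
    isomorphism over B: every test arrow and every candidate factorization in E' is the image of one
    in E. The comparison functors therefore need no separate check on lifts. *)
Lemma iso_cartesian_functor (E E' B : Category) (P : Functor E B)
    (P' : Functor E' B) (F : Functor E E') (G : Functor E' E) :
  functor_comp P' F = P ->
  functor_comp G F = functor_id E -> functor_comp F G = functor_id E' ->
  cartesian_functor P P' F.
Proof.
  intros <- HGF HFG a b m Hm d n w H.
  assert (Hd : exists d0, F d0 = d).
  { exists (G d). change (functor_comp F G d = functor_id E' d). now rewrite HFG. }
  destruct Hd as [d0 <-].
  destruct (iso_full HGF HFG n) as [n0 <-].
  destruct (Hm d0 n0 w H) as [h [[H1 H2] H3]].
  exists (fmap F h). split.
  - split; [exact H1 | now rewrite <- H2, fmap_comp].
  - intros h' [H4 H5]. destruct (iso_full HGF HFG h') as [h0 <-].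
    f_equal. apply H3. split; [exact H4 |].
    apply (left_inverse_faithful HGF). now rewrite fmap_comp.
Qed.

(** * Functors from a relation between hom-sets *)

Section HomCorrespondence.

Variables (L R : Category) (O : Type) (mkL : O -> L) (mkR : O -> R).
Variables (unL : L -> O) (mkLK : forall e, mkL (unL e) = e).
Variable (unLK : forall o, unL (mkL o) = o).
Variable rel : forall o o', Hom (mkL o) (mkL o') -> Hom (mkR o) (mkR o') -> Prop.
Arguments rel {o o'} _ _.
Hypothesis rel_fun : forall o o' (f : Hom (mkL o) (mkL o')), exists! g, rel f g.
Hypothesis rel_inv : forall o o' (g : Hom (mkR o) (mkR o')), exists! f, rel f g.
Hypothesis rel_comp : forall o1 o2 o3
  (f' : Hom (mkL o2) (mkL o3)) (f : Hom (mkL o1) (mkL o2)) g' g,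
  rel f' g' -> rel f g -> rel (f' ∘ f) (g' ∘ g).

(** [mkL (unL a) = a] is only propositional, so f is moved to the objects [mkL (unL _)] by composing
    with [idto] on both sides. *)
Definition conj_unL (a b : L) (f : Hom a b) : Hom (mkL (unL a)) (mkL (unL b)) :=
  idto (eq_sym (mkLK b)) ∘ f ∘ idto (mkLK a).

Lemma conj_unL_heq (a b : L) (f : Hom a b) : heq (conj_unL f) f.
Proof. eapply heq_trans; [apply heq_idto_r | apply heq_idto_l]. Qed.

Definition rel_image o o' (f : Hom (mkL o) (mkL o')) : Hom (mkR o) (mkR o') :=
  proj1_sig (constructive_indefinite_description _ (rel_fun f)).

Lemma rel_imageP o o' (f : Hom (mkL o) (mkL o')) : rel f (rel_image f).
Proof.
  unfold rel_image. destruct constructive_indefinite_description as [g Hg].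
  apply Hg.
Qed.

Lemma rel_image_uniq o o' (f : Hom (mkL o) (mkL o')) g :
  rel f g -> rel_image f = g.
Proof.
  intro H. destruct (rel_fun f) as [g' [_ K]].
  rewrite <- (K _ H). symmetry. apply K, rel_imageP.
Qed.

(** Let f be related to the identity of [mkR o]. Compatibility with composition, applied to the
    identity of [mkL o] and f, relates f to the image of the identity as well, and the image of f is
    unique. *)
Lemma rel_id o : rel (idc (mkL o)) (idc (mkR o)).
Proof.
  destruct (rel_inv (idc (mkR o))) as [f [Hf _]].
  pose proof (rel_comp (rel_imageP (idc (mkL o))) Hf) as H.
  rewrite comp_idl, comp_idr in H.
  apply rel_image_uniq in Hf. apply rel_image_uniq in H.
  rewrite <- Hf, H. apply rel_imageP.
Qed.

Lemma rel_functor_id (a : L) :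
  rel_image (conj_unL (idc a)) = idc (mkR (unL a)).
Proof.
  apply rel_image_uniq.
  assert (conj_unL (idc a) = idc _) as ->.
  { apply heq_eq. eapply heq_trans; [apply conj_unL_heq |].
    apply heq_idc. symmetry. apply mkLK. }
  apply rel_id.
Qed.

Lemma rel_functor_comp (a b c : L) (g : Hom b c) (f : Hom a b) :
  rel_image (conj_unL (g ∘ f))
  = rel_image (conj_unL g) ∘ rel_image (conj_unL f).
Proof.
  apply rel_image_uniq.
  assert (conj_unL (g ∘ f) = conj_unL g ∘ conj_unL f) as ->.
  { apply heq_eq. eapply heq_trans; [apply conj_unL_heq |].
    apply heq_sym, heq_comp; apply conj_unL_heq. }
  apply rel_comp; apply rel_imageP.
Qed.

Definition rel_functor : Functor L R :=
  {| fob := fun e => mkR (unL e);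
     fmap := fun a b f => rel_image (conj_unL f);
     fmap_id := rel_functor_id;
     fmap_comp := rel_functor_comp |}.

(** The functor can be evaluated at any f0 equal to f up to [heq], which avoids transports along
    [unL (mkL o) = o] when two such functors are composed. *)
Lemma rel_functor_heq (a b : L) (f : Hom a b) o o'
    (f0 : Hom (mkL o) (mkL o')) g :
  heq f f0 -> rel f0 g -> heq (fmap rel_functor f) g.
Proof.
  intros H Hg. simpl.
  assert (K : heq (conj_unL f) f0).
  { eapply heq_trans; [apply conj_unL_heq | exact H]. }
  revert K. generalize (conj_unL f).
  assert (unL a = o) as ->. { rewrite (heq_dom H). apply unLK. }
  assert (unL b = o') as ->. { rewrite (heq_cod H). apply unLK. }
  intros f1 K. apply heq_eq in K. subst f1.
  apply heq_of_eq. now apply rel_image_uniq.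
Qed.

End HomCorrespondence.

Section IsoOfRel.

Variables (L R B : Category) (P : Fibration L B) (P' : Fibration R B).
Variables (O : Type) (mkL : O -> L) (mkR : O -> R).
Variables (unL : L -> O) (unR : R -> O).
Hypothesis mkLK : forall e, mkL (unL e) = e.
Hypothesis unLK : forall o, unL (mkL o) = o.
Hypothesis mkRK : forall e, mkR (unR e) = e.
Hypothesis unRK : forall o, unR (mkR o) = o.
Variable rel : forall o o', Hom (mkL o) (mkL o') -> Hom (mkR o) (mkR o') -> Prop.
Arguments rel {o o'} _ _.
Hypothesis rel_fun : forall o o' (f : Hom (mkL o) (mkL o')), exists! g, rel f g.
Hypothesis rel_inv : forall o o' (g : Hom (mkR o) (mkR o')), exists! f, rel f g.
Hypothesis rel_comp : forall o1 o2 o3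
  (f' : Hom (mkL o2) (mkL o3)) (f : Hom (mkL o1) (mkL o2)) g' g,
  rel f' g' -> rel f g -> rel (f' ∘ f) (g' ∘ g).
Hypothesis rel_over : forall o o' (f : Hom (mkL o) (mkL o')) g,
  rel f g -> heq (fmap P' g) (fmap P f).

(** The hypotheses on [rel] are symmetric in the two sides, so the flipped relation gives a functor
    back. It returns [conj_unL f], the unique arrow related to the image. *)
Lemma rel_functor_inverse :
  functor_comp
    (rel_functor mkRK (rel := fun o o' g f => rel f g) rel_inv rel_fun
       (fun o1 o2 o3 g' g f' f => @rel_comp o1 o2 o3 f' f g' g))
    (rel_functor mkLK rel_fun rel_inv rel_comp)
  = functor_id L.
Proof.
  apply functor_eq.
  - intro a. simpl. now rewrite unRK.
  - intros a b f.
    apply heq_trans with (g := conj_unL mkLK f); [| apply conj_unL_heq].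
    exact (@rel_functor_heq R L O mkR mkL unR mkRK unRK
      (fun o o' g f => rel f g) rel_inv rel_fun _ _ _ _ _ _ _ _ (heq_refl _)
      (rel_imageP rel_fun (conj_unL mkLK f))).
Qed.

Lemma rel_functor_over :
  functor_comp P' (rel_functor mkLK rel_fun rel_inv rel_comp) = P.
Proof.
  assert (H : forall (a b : L) (f : Hom a b),
    heq (fmap P' (fmap (rel_functor mkLK rel_fun rel_inv rel_comp) f)) (fmap P f)).
  { intros a b f.
    eapply heq_trans; [exact (rel_over (rel_imageP rel_fun (conj_unL mkLK f))) |].
    apply heq_fmap, conj_unL_heq. }
  apply functor_eq; [| exact H].
  intro a. exact (heq_dom (H a a (idc a))).
Qed.

End IsoOfRel.

(** The relation is the graph of bijections on hom-sets; it yields mutually inverse functors over B,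
    which preserve cartesian arrows because they are isomorphisms. *)
Lemma fib_iso_of_rel (L R B : Category) (P : Fibration L B)
    (P' : Fibration R B) (O : Type) (mkL : O -> L) (mkR : O -> R)
    (unL : L -> O) (unR : R -> O)
    (rel : forall o o', Hom (mkL o) (mkL o') -> Hom (mkR o) (mkR o') -> Prop) :
  (forall e, mkL (unL e) = e) -> (forall o, unL (mkL o) = o) ->
  (forall e, mkR (unR e) = e) -> (forall o, unR (mkR o) = o) ->
  (forall o o' (f : Hom (mkL o) (mkL o')), exists! g, rel o o' f g) ->
  (forall o o' (g : Hom (mkR o) (mkR o')), exists! f, rel o o' f g) ->
  (forall o1 o2 o3 (f' : Hom (mkL o2) (mkL o3)) (f : Hom (mkL o1) (mkL o2)) g' g,
    rel o2 o3 f' g' -> rel o1 o2 f g -> rel o1 o3 (f' ∘ f) (g' ∘ g)) ->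
  (forall o o' (f : Hom (mkL o) (mkL o')) g,
    rel o o' f g -> heq (fmap P' g) (fmap P f)) ->
  fib_iso P P'.
Proof.
  intros mkLK unLK mkRK unRK rel_fun rel_inv rel_comp rel_over.
  pose (rel_comp' := fun o1 o2 o3 g' g f' f => rel_comp o1 o2 o3 f' f g' g).
  set (F := rel_functor mkLK rel_fun rel_inv rel_comp).
  set (G := rel_functor mkRK (rel := fun o o' g f => rel o o' f g)
              rel_inv rel_fun rel_comp').
  assert (HF : functor_comp P' F = P) by (apply rel_functor_over; assumption).
  assert (HG : functor_comp P G = P').
  { apply rel_functor_over. intros. now apply heq_sym, rel_over. }
  assert (HGF : functor_comp G F = functor_id L).
  { exact (rel_functor_inverse mkLK mkRK unRK rel_fun rel_inv rel_comp). }
  assert (HFG : functor_comp F G = functor_id R).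
  { exact (rel_functor_inverse mkRK mkLK unLK
      (rel := fun o o' g f => rel o o' f g) rel_inv rel_fun rel_comp'). }
  exists F, G. repeat split; auto;
    [apply iso_cartesian_functor with (G := G)
    | apply iso_cartesian_functor with (G := F)]; assumption.
Qed.

(** * The action of dual arrows, and twofold duals *)

Section DualAction.

Variables (E B : Category) (Q : Fibration E B).

(** An arrow e -> d of the dual over u is the same as a natural family of maps
    from the arrows x -> d over u ∘ w to the arrows x -> e over w. *)
Definition dual_act (e d x : E) (f : DualHom Q e d) (c : Hom x d)
    (v : Hom x e) : Prop :=
  exists i : Hom x (pull Q d (dh_base f)),
    lift Q d (dh_base f) ∘ i = c /\ dh_fib f ∘ i = v.

(** Factoring p through the lift of the composite base gives k. The comparison maps t and s of the
    dual composition send k to the witnesses i and j, by uniqueness of factorizations through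
    cartesian arrows. *)
Lemma dual_act_comp (e d c x : E) (g : DualHom Q d c) (f : DualHom Q e d)
    (p : Hom x c) (q : Hom x d) (r : Hom x e) :
  dual_act g p q -> dual_act f q r -> dual_act (dual_comp g f) p r.
Proof.
  intros [i [Hi1 Hi2]] [j [Hj1 Hj2]].
  assert (Hgi : heq (fmap Q q) (fmap Q i)).
  { rewrite <- Hi2. eapply over_vert_l; [constructor | apply dh_vert]. }
  destruct (dual_comp_spec g f) as [_ [t [s [Ht [Et [Hs [Es Ek]]]]]]].
  (* [fmap Q j] with its codomain rewritten to [Q e], the domain of [dh_base f]. *)
  set (w := idto (heq_dom (lift_over Q d (dh_base f))) ∘ fmap Q j).
  assert (Hw : heq (fmap Q j) w) by (apply heq_sym, heq_idto_l).
  assert (Hqj : heq (fmap Q q) (dh_base f ∘ w)).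
  { rewrite <- Hj1. apply over_comp; [exact Hw | apply lift_over]. }
  destruct (hfactor_ex (w := w) (lift_cart Q c (dh_base (dual_comp g f)))
    (lift_over Q c _) (n := p)) as [k [Hk1 Hk2]].
  { rewrite <- Hi1. simpl. rewrite <- comp_assoc.
    apply over_comp; [| apply lift_over].
    eapply heq_trans; [apply heq_sym, Hgi | exact Hqj]. }
  assert (Htk : t ∘ k = i).
  { eapply hfactor_uniq; [apply (lift_cart Q c (dh_base g)) | | |].
    - apply over_comp; [exact Hk1 | exact Ht].
    - eapply heq_trans; [apply heq_sym, Hgi | exact Hqj].
    - now rewrite comp_assoc, Et, Hk2. }
  assert (Hsk : s ∘ k = j).
  { eapply hfactor_uniq; [apply (lift_cart Q d (dh_base f)) | | exact Hw |].
    - eapply over_vert_l; [exact Hk1 | exact Hs].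
    - now rewrite comp_assoc, Es, <- comp_assoc, Htk, Hj1. }
  exists k. split; [exact Hk2 |].
  now rewrite Ek, <- comp_assoc, Hsk.
Qed.

Lemma dual_act_comp_inv (e d c x : E) (g : DualHom Q d c) (f : DualHom Q e d)
    (p : Hom x c) (r : Hom x e) :
  dual_act (dual_comp g f) p r ->
  exists q : Hom x d, dual_act g p q /\ dual_act f q r.
Proof.
  intros [k [Hk1 Hk2]].
  destruct (dual_comp_spec g f) as [_ [t [s [Ht [Et [Hs [Es Ek]]]]]]].
  exists (dh_fib g ∘ t ∘ k). split.
  - exists (t ∘ k). split; [now rewrite comp_assoc, Et | apply comp_assoc].
  - exists (s ∘ k). split.
    + now rewrite comp_assoc, Es.
    + now rewrite <- Hk2, Ek, comp_assoc.
Qed.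

(** The vertical part of [dual_lift] is the canonical isomorphism between two reindexings of e, so
    acting by it amounts to factoring through the original lift of Q. *)
Lemma dual_act_lift (b : B) (e x : E) (u : Hom b (Q e)) (c : Hom x e)
    (v : Hom x (pull Q e u)) :
  dual_act (dual_lift u) c v <-> lift Q e u ∘ v = c.
Proof.
  split.
  - intros [i [<- <-]]. simpl. now rewrite comp_assoc, hfactor_eq.
  - intros <-.
    destruct (hfactor_ex (w := fmap Q v) (lift_cart Q e (fmap Q (lift Q e u)))
      (lift_over Q e _) (n := lift Q e u ∘ v)) as [i [Hi1 Hi2]].
    { rewrite fmap_comp. constructor. }
    exists i. split; [exact Hi2 |]. simpl.
    eapply hfactor_uniq; [apply (lift_cart Q e u) | | constructor |].
    + eapply over_vert_l; [exact Hi1 | apply hfactor_over].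
    + now rewrite comp_assoc, hfactor_eq.
Qed.

(** A twofold dual arrow from e to e' is an arrow [k] of the dual from a
    reindexing of e' to e; such arrows compose as the spans
    e <- (dh_base k)^*e -> e' in E. *)
Lemma dual_dual_comp (e e' e'' : E) (b b' b'' : B) (u : Hom b (Q e'))
    (u' : Hom b' (Q e'')) (u'' : Hom b'' (Q e''))
    (k : DualHom Q (pull Q e' u) e) (k' : DualHom Q (pull Q e'' u') e')
    (k'' : DualHom Q (pull Q e'' u'') e)
    (s : DualHom Q (pull Q e'' u'') (pull Q e' u))
    (t : DualHom Q (pull Q e'' u'') (pull Q e'' u')) :
  k'' = dual_comp k s ->
  dual_comp (dual_lift u') t = dual_lift u'' ->
  dual_comp (dual_lift u) s = dual_comp k' t ->
  exists (i : Hom (pull Q e (dh_base k'')) (pull Q e (dh_base k)))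
         (j : Hom (pull Q e (dh_base k'')) (pull Q e' (dh_base k'))),
    heq (fmap Q i) (dh_base s) /\ heq (fmap Q j) (dh_base t) /\
    lift Q e (dh_base k) ∘ i = lift Q e (dh_base k'') /\
    lift Q e' u ∘ dh_fib k ∘ i = lift Q e' (dh_base k') ∘ j /\
    lift Q e'' u' ∘ dh_fib k' ∘ j = lift Q e'' u'' ∘ dh_fib k''.
Proof.
  intros -> Ht Hs.
  destruct (dual_comp_spec k s) as [_ [i [m [Hi [Ei [Hm [Em Ek]]]]]]].
  assert (As : dual_act s (dh_fib k ∘ i) (dh_fib (dual_comp k s))).
  { exists m. split; [exact Em | now rewrite Ek]. }
  (* [Hs] is evaluated on this arrow into [e']: the left-hand side is computed from s, and splitting
     the action of the right-hand side gives the witness j for [k']. *)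
  assert (A : dual_act (dual_comp (dual_lift u) s)
    (lift Q e' u ∘ (dh_fib k ∘ i)) (dh_fib (dual_comp k s))).
  { eapply dual_act_comp; [| exact As]. now apply dual_act_lift. }
  rewrite Hs in A. destruct (dual_act_comp_inv A) as [q [[j [Ej1 Ej2]] At]].
  assert (A' : dual_act (dual_comp (dual_lift u') t)
    (lift Q e'' u' ∘ q) (dh_fib (dual_comp k s))).
  { eapply dual_act_comp; [| exact At]. now apply dual_act_lift. }
  rewrite Ht in A'. apply dual_act_lift in A'.
  exists i, j. split; [exact Hi |]. split.
  (* The witness l of the action of t on q is vertical, so q lies over [dh_base t]; j has the same
     image in B as q. *)
  - destruct At as [l [El1 El2]].
    assert (Hl : heq (fmap Q l) (idc (Q (pull Q e'' u'')))).
    { eapply heq_trans; [| exact (dh_vert (dual_comp k s))].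
      rewrite <- El2. apply heq_sym.
      eapply over_vert_l; [constructor | apply dh_vert]. }
    assert (Hq : heq (fmap Q q) (fmap Q j)).
    { rewrite <- Ej2. eapply over_vert_l; [constructor | apply dh_vert]. }
    eapply heq_trans; [apply heq_sym, Hq |].
    rewrite <- El1. eapply over_vert_r; [exact Hl | apply lift_over].
  - split; [exact Ei |]. split.
    + now rewrite <- comp_assoc, Ej1.
    + now rewrite <- comp_assoc, Ej2, A'.
Qed.

End DualAction.

(** * Spans between the unwound objects *)

Section DialSpans.

Variables (C E : Category) (T : FinProducts C) (P : Fibration E C).

(** The common unwinding of the objects of both sides: [do_ctx] is (I, X), [do_snd] is Y, and
    [do_fib] is α, over (I × X) × Y. *)
Record DialOb := {
  do_ctx : Simple T;
  do_snd : C;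
  do_fib : E;
  do_eq : prd T (simple_prod T do_ctx) do_snd = P do_fib
}.

Definition fst_id (A Y Y' : C) (g : Hom (prd T A Y') Y) :
    @Hom (Simple T) (A, Y') (A, Y) :=
  @Build_SimpleHom C T (A, Y') (A, Y) (idc A) g.

Definition snd_id (A A' Y : C) (u : Hom A A') :
    @Hom (Simple T) (A, Y) (A', Y) :=
  @simple_lift C T A (A', Y) u.

(** The left leg lies over (z, y') ↦ (z, g (z, y')) for g = [ds_snd], the right
    leg over (z, y') ↦ (v z, y') for v = simple_prod [ds_ctx]. *)
Record DialSpan (o o' : DialOb) := {
  ds_ctx : @Hom (Simple T) (do_ctx o) (do_ctx o');
  ds_snd : Hom (prd T (simple_prod T (do_ctx o)) (do_snd o')) (do_snd o);
  ds_apex : E;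
  ds_left : Hom ds_apex (do_fib o);
  ds_right : Hom ds_apex (do_fib o');
  ds_cart : cartesian P ds_left;
  ds_left_over :
    heq (fmap P ds_left) (fmap (simple_prod T) (fst_id ds_snd));
  ds_right_over :
    heq (fmap P ds_right)
      (fmap (simple_prod T) (snd_id (do_snd o') (fmap (simple_prod T) ds_ctx)))
}.

#[global] Arguments ds_cart {o o'} d.

Definition span_iso (o o' : DialOb) (s t : DialSpan o o') : Prop :=
  ds_ctx s = ds_ctx t /\ ds_snd s = ds_snd t /\
  exists i : Hom (ds_apex s) (ds_apex t),
    heq (fmap P i) (idc (P (ds_apex s))) /\
    ds_left t ∘ i = ds_left s /\ ds_right t ∘ i = ds_right s.

Lemma span_dom (o o' : DialOb) (s : DialSpan o o') :
  P (ds_apex s) = prd T (simple_prod T (do_ctx o)) (do_snd o').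
Proof. exact (heq_dom (ds_left_over s)). Qed.

Lemma span_left_factor (o o' : DialOb) (s t : DialSpan o o') :
  ds_snd s = ds_snd t ->
  exists i : Hom (ds_apex s) (ds_apex t),
    heq (fmap P i) (idc (P (ds_apex s))) /\ ds_left t ∘ i = ds_left s.
Proof.
  intro H.
  destruct (hfactor_ex (w := idc _) (ds_cart t) (ds_left_over t)
    (n := ds_left s)) as [i [Hi Ei]].
  { apply heq_id_r. rewrite <- H. apply ds_left_over. }
  exists i. split; [| exact Ei].
  eapply heq_trans; [exact Hi |]. apply heq_idc. symmetry. apply span_dom.
Qed.

(** The left legs are cartesian over the same arrow, so the factorization j of one through the other
    is a right inverse of the comparison i. *)
Lemma span_iso_sym (o o' : DialOb) (s t : DialSpan o o') :
  span_iso s t -> span_iso t s.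
Proof.
  intros [Hm [Hg [i [Hi [Ei Fi]]]]].
  split; [now symmetry |]. split; [now symmetry |].
  destruct (span_left_factor (eq_sym Hg)) as [j [Hj Ej]].
  exists j. split; [exact Hj |]. split; [exact Ej |].
  rewrite <- Fi, <- comp_assoc.
  assert (i ∘ j = idc _) as ->; [| apply comp_idr].
  eapply hfactor_uniq; [exact (ds_cart t) | | |].
  - eapply over_vert_l; [exact Hj | exact Hi].
  - now apply over_id.
  - now rewrite comp_assoc, Ei, Ej, comp_idr.
Qed.

Lemma span_iso_trans (o o' : DialOb) (r s t : DialSpan o o') :
  span_iso r s -> span_iso s t -> span_iso r t.
Proof.
  intros [Hm [Hg [i [Hi [Ei Fi]]]]] [Hm' [Hg' [j [Hj [Ej Fj]]]]].
  split; [congruence |]. split; [congruence |].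
  exists (j ∘ i). split; [eapply over_vert_l; eassumption |].
  now rewrite !comp_assoc, Ej, Fj, Ei, Fi.
Qed.

(** The map (z, y'') ↦ g' (v z, y''), where v is induced by s and g' is [ds_snd t]. *)
Definition comp_snd (o1 o2 o3 : DialOb) (t : DialSpan o2 o3)
    (s : DialSpan o1 o2) :
    Hom (prd T (simple_prod T (do_ctx o1)) (do_snd o3)) (do_snd o2) :=
  ds_snd t
  ∘ fmap (simple_prod T) (snd_id (do_snd o3) (fmap (simple_prod T) (ds_ctx s))).

(** A relation rather than an operation, since the apex matters only up to vertical isomorphism. The
    arrows i and j form the commuting square over which the spans are composed. *)
Definition span_comp_rel (o1 o2 o3 : DialOb) (t : DialSpan o2 o3)
    (s : DialSpan o1 o2) (r : DialSpan o1 o3) : Prop :=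
  ds_ctx r = ds_ctx t ∘ ds_ctx s /\
  ds_snd r = ds_snd s ∘ fmap (simple_prod T) (fst_id (comp_snd t s)) /\
  exists (i : Hom (ds_apex r) (ds_apex s)) (j : Hom (ds_apex r) (ds_apex t)),
    heq (fmap P i) (fmap (simple_prod T) (fst_id (comp_snd t s))) /\
    heq (fmap P j) (fmap (simple_prod T)
      (snd_id (do_snd o3) (fmap (simple_prod T) (ds_ctx s)))) /\
    ds_left s ∘ i = ds_left r /\
    ds_right s ∘ i = ds_left t ∘ j /\
    ds_right t ∘ j = ds_right r.

(** The left legs give a comparison l of the apexes. Uniqueness against the left leg of [s'] makes l
    commute with i and [i'], then uniqueness against that of [t'] does so for j and [j'], and the
    right legs agree. *)
Lemma span_comp_rel_iso (o1 o2 o3 : DialOb) (t t' : DialSpan o2 o3)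
    (s s' : DialSpan o1 o2) (r r' : DialSpan o1 o3) :
  span_iso t t' -> span_iso s s' ->
  span_comp_rel t s r -> span_comp_rel t' s' r' -> span_iso r r'.
Proof.
  intros [Hmt [Hgt [p [Hp [Ep Fp]]]]] [Hms [Hgs [q [Hq [Eq Fq]]]]]
    [Hm [Hg [i [j [Hi [Hj [Ei [Eij Ej]]]]]]]]
    [Hm' [Hg' [i' [j' [Hi' [Hj' [Ei' [Eij' Ej']]]]]]]].
  assert (Hc : comp_snd t' s' = comp_snd t s).
  { unfold comp_snd. now rewrite Hgt, Hms. }
  rewrite Hc in *.
  assert (K : ds_snd r = ds_snd r') by congruence.
  split; [congruence |]. split; [exact K |].
  destruct (span_left_factor K) as [l [Hl El]].
  exists l. split; [exact Hl |]. split; [exact El |].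
  assert (Hil : i' ∘ l = q ∘ i).
  { eapply hfactor_uniq; [exact (ds_cart s') | | |].
    - eapply over_vert_r; [exact Hl | exact Hi'].
    - eapply over_vert_l; [exact Hi | exact Hq].
    - now rewrite !comp_assoc, Ei', Eq, Ei. }
  assert (Hjl : j' ∘ l = p ∘ j).
  { eapply hfactor_uniq; [exact (ds_cart t') | | |].
    - eapply over_vert_r; [exact Hl | exact Hj'].
    - rewrite <- Hms. eapply over_vert_l; [exact Hj | exact Hp].
    - rewrite !comp_assoc, <- Eij', Ep, <- comp_assoc, Hil.
      now rewrite comp_assoc, Fq. }
  now rewrite <- Ej', <- comp_assoc, Hjl, comp_assoc, Fp.
Qed.

End DialSpans.

Lemma SimpleHom_eq (C : Category) (T : FinProducts C) (s t : C * C)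
    (f g : SimpleHom T s t) :
  sh_base f = sh_base g -> sh_fib f = sh_fib g -> f = g.
Proof. destruct f, g; simpl. now intros -> ->. Qed.

(** * Arrows of Dial(P) as spans *)

Section DialHoms.

Variables (C E : Category) (T : FinProducts C) (P : Fibration E C).

Definition dial_ob (o : DialOb T P) : SumCat T (Prod T P) :=
  @Build_PbOb (Dual (Sum T (dual P))) (Simple T) C (Prod T P) (simple_prod T)
    (do_ctx o)
    (@Build_PbOb (Dual P) (Simple T) C (dual P) (simple_prod T)
       (simple_prod T (do_ctx o), do_snd o) (do_fib o) (do_eq o))
    eq_refl.

Definition dial_unob (e : SumCat T (Prod T P)) : DialOb T P :=
  @Build_DialOb C E T P (pb_base e) (snd (pb_base (pb_tot e)))
    (pb_tot (pb_tot e))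
    (eq_trans (f_equal (fun A => prd T A _) (pb_ob_eq e))
       (pb_ob_eq (pb_tot e))).

Lemma dial_unobK (e : SumCat T (Prod T P)) : dial_ob (dial_unob e) = e.
Proof.
  destruct e as [s [[J Y] a H] K]. simpl in K. subst J.
  unfold dial_ob, dial_unob; simpl. now rewrite eq_trans_refl_l.
Qed.

Lemma dial_obK (o : DialOb T P) : dial_unob (dial_ob o) = o.
Proof.
  destruct o. unfold dial_unob; simpl. f_equal. apply proof_irrelevance.
Qed.

Section DialSpan.

Variables (o o' : DialOb T P) (f : Hom (dial_ob o) (dial_ob o')).

Definition dial_hom_fib :
    PbHom (pull (Sum T (dual P)) (pb_tot (dial_ob o')) (dh_base (pbh_tot f)))
      (pb_tot (dial_ob o)) :=
  dh_fib (pbh_tot f).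

Definition dial_hom_snd :
    Hom (prd T (simple_prod T (do_ctx o)) (do_snd o')) (do_snd o) :=
  sh_fib (pbh_base dial_hom_fib).

Definition dial_hom_left :
    Hom (pull P (do_fib o) (dh_base (pbh_tot dial_hom_fib))) (do_fib o) :=
  lift P (do_fib o) (dh_base (pbh_tot dial_hom_fib)).

(** The vertical part of the inner dual arrow lands in the reindexing of α' along (z, y') ↦ (v z,
    y'); it is followed by the cartesian lift to α'. *)
Definition dial_hom_right :
    Hom (pull P (do_fib o) (dh_base (pbh_tot dial_hom_fib))) (do_fib o') :=
  pbh_tot (pb_lift (P := P) (t :=
    @Build_PbOb E (Simple T) C P (simple_prod T)
       (simple_prod T (do_ctx o'), do_snd o') (do_fib o') (do_eq o'))
     (snd_id T (do_snd o') (dh_base (pbh_tot f))))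
  ∘ dh_fib (pbh_tot dial_hom_fib).

Lemma dial_hom_base :
  dh_base (pbh_tot f) = fmap (simple_prod T) (pbh_base f).
Proof. symmetry. apply heq_eq. exact (pbh_eq f). Qed.

(** Verticality over I × X in the outer dual leaves only the component g free. *)
Lemma dial_hom_fib_base : pbh_base dial_hom_fib = fst_id dial_hom_snd.
Proof.
  pose proof (heq_eq (dh_vert (pbh_tot f))) as H.
  change (sh_base (pbh_base dial_hom_fib) = idc _) in H.
  unfold dial_hom_snd. destruct (pbh_base dial_hom_fib) as [h k].
  simpl in *. now subst h.
Qed.

Lemma dial_hom_left_over :
  heq (fmap P dial_hom_left) (fmap (simple_prod T) (fst_id dial_hom_snd)).
Proof.
  eapply heq_trans; [apply lift_over |].
  rewrite <- dial_hom_fib_base. exact (heq_sym (pbh_eq dial_hom_fib)).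
Qed.

Lemma dial_hom_right_over :
  heq (fmap P dial_hom_right) (fmap (simple_prod T)
    (snd_id T (do_snd o') (fmap (simple_prod T) (pbh_base f)))).
Proof.
  rewrite <- dial_hom_base.
  eapply over_vert_r; [apply dh_vert |]. exact (heq_sym (pbh_eq (pb_lift _))).
Qed.

Definition dial_span : DialSpan o o' :=
  {| ds_ctx := pbh_base f;
     ds_snd := dial_hom_snd;
     ds_apex := pull P (do_fib o) (dh_base (pbh_tot dial_hom_fib));
     ds_left := dial_hom_left;
     ds_right := dial_hom_right;
     ds_cart := lift_cart P _ _;
     ds_left_over := dial_hom_left_over;
     ds_right_over := dial_hom_right_over |}.

End DialSpan.

(** The context and g determine every base component of an arrow; the remaining vertical arrow is
    recovered from the right leg, since it is followed there by a cartesian lift. *)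
Lemma dial_span_inj (o o' : DialOb T P) (f f' : Hom (dial_ob o) (dial_ob o')) :
  span_iso (dial_span f) (dial_span f') -> f = f'.
Proof.
  intros [Hm [Hg [i [Hi [Ei Fi]]]]].
  pose proof (dial_hom_base f) as B. pose proof (dial_hom_base f') as B'.
  pose proof (dial_hom_fib_base f) as K. pose proof (dial_hom_fib_base f') as K'.
  change (pbh_base f = pbh_base f') in Hm.
  change (dial_hom_snd f = dial_hom_snd f') in Hg. rewrite Hg in K. rewrite <- K' in K. clear K'.
  rewrite Hm in B. rewrite <- B' in B. clear B' Hg.
  apply PbHom_eq; [exact Hm | clear Hm].
  destruct f as [m [u k Hk] Hf], f' as [m' [u' k' Hk'] Hf'].
  simpl in B. subst u'. change (pbh_base k = pbh_base k') in K.
  apply DualHom_eq; [reflexivity | apply heq_of_eq].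
  apply PbHom_eq; [exact K |].
  pose proof (pbh_eq k) as V. pose proof (pbh_eq k') as V'.
  rewrite K in V. pose proof (heq_eq (heq_trans (heq_sym V) V')) as W.
  destruct k as [kb [w x Hx] Hkb], k' as [kb' [w' x' Hx'] Hkb'].
  simpl in W. subst w'.
  apply DualHom_eq; [reflexivity | apply heq_of_eq].
  simpl in i, Hi, Ei, Fi. unfold dial_hom_left, dial_hom_right in *. simpl in *.
  (* Both left legs are now the same chosen lift. *)
  assert (i = idc _) as ->.
  { eapply hfactor_uniq; [apply lift_cart | exact Hi | now apply over_id |].
    now rewrite comp_idr. }
  rewrite comp_idr in Fi.
  eapply hfactor_uniq; [apply lift_cart | exact Hx | exact Hx' | now symmetry].
Qed.

Lemma dial_span_surj (o o' : DialOb T P) (s : DialSpan o o') :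
  exists f, span_iso (dial_span f) s.
Proof.
  set (u := fmap (simple_prod T) (ds_ctx s)).
  set (t' := pb_tot (dial_ob o')).
  set (t := pb_tot (dial_ob o)).
  set (tP := @Build_PbOb E (Simple T) C P (simple_prod T)
       (simple_prod T (do_ctx o'), do_snd o') (do_fib o') (do_eq o')).
  set (l := pb_lift (P := P) (t := tP) (snd_id T (do_snd o') u)).
  set (b := fst_id (ds_snd s)).
  set (p := pull (Sum T (dual P)) t' u).
  (* The image of b under [simple_prod], with endpoints rewritten to those that an arrow of the dual
     of P requires. *)
  assert (Hw : exists w : Hom (P (pb_tot p)) (P (do_fib o)),
    heq (fmap (simple_prod T) b) w).
  { exists (idto (do_eq o) ∘ fmap (simple_prod T) b ∘ idto (eq_sym (pb_ob_eq p))).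
    apply heq_sym. eapply heq_trans; [apply heq_idto_r | apply heq_idto_l]. }
  destruct Hw as [w Hw].
  (* The left leg of the span to be built is the chosen lift of w; i compares it with the given left
     leg, and x below is the vertical factor of the given right leg precomposed with i. *)
  destruct (hfactor_ex (w := idc _) (ds_cart s) (ds_left_over s)
    (n := lift P (do_fib o) w)) as [i [Hi Ei]].
  { apply heq_id_r. eapply heq_trans; [apply lift_over | apply heq_sym, Hw]. }
  destruct (hfactor_ex (w := idc _) (lift_cart P _ _)
    (heq_sym (pbh_eq l)) (n := ds_right s ∘ i)) as [x [Hx' Ex]].
  { apply heq_id_r. eapply over_vert_r; [exact Hi | apply ds_right_over]. }
  assert (Hx : heq (fmap P x) (idc (P (pb_tot p)))).
  { exact (heq_trans Hx' (heq_idc (pb_ob_eq p))). }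
  set (k := @Build_PbHom _ _ _ (dual P) (simple_prod T) p t b
              (@Build_DualHom _ _ P (pb_tot p) (do_fib o) w x Hx) Hw).
  set (f := @Build_PbHom _ _ _ (Prod T P) (simple_prod T)
    (dial_ob o) (dial_ob o') (ds_ctx s)
    (@Build_DualHom _ _ (Sum T (dual P)) t t' u k (heq_refl _)) (heq_refl _)).
  exists f. split; [reflexivity |]. split; [reflexivity |].
  exists i. split; [| split; [exact Ei | now symmetry]].
  eapply heq_trans; [exact Hi |]. apply heq_idc. symmetry.
  exact (span_dom (dial_span f)).
Qed.

(** The components in the dual of P of the equations defining the outer composite are exactly the
    hypotheses of [dual_dual_comp]. *)
Lemma dial_span_comp (o1 o2 o3 : DialOb T P)
    (g : Hom (dial_ob o2) (dial_ob o3)) (f : Hom (dial_ob o1) (dial_ob o2)) :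
  span_comp_rel (dial_span g) (dial_span f) (dial_span (g ∘ f)).
Proof.
  destruct (dual_comp_spec (pbh_tot g) (pbh_tot f))
    as [_ [t [s [Ht [Et [Hs [Es Ek]]]]]]].
  destruct (dual_dual_comp (f_equal (@pbh_tot _ _ _ _ _ _ _) Ek)
    (f_equal (@pbh_tot _ _ _ _ _ _ _) Et)
    (f_equal (@pbh_tot _ _ _ _ _ _ _) Es))
    as [i [j [Hi [Hj [Ei [Eij Ej]]]]]].
  (* The components of the same equations in S(C) identify the bases of t and s, hence the arrows
     over which j and i lie. *)
  assert (Bt : pbh_base t = snd_id T (do_snd o3) (fmap (simple_prod T) (pbh_base f))).
  { rewrite <- dial_hom_base.
    pose proof (f_equal (@sh_fib _ _ _ _) (f_equal (@pbh_base _ _ _ _ _ _ _) Et)) as K. simpl in K.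
    rewrite pairing_pr2 in K.
    pose proof (heq_eq Ht) as K'. simpl in K'.
    apply SimpleHom_eq; [exact K' | exact K]. }
  assert (Bs : pbh_base s = fst_id (comp_snd (dial_span g) (dial_span f))).
  { pose proof (f_equal (@sh_fib _ _ _ _) (f_equal (@pbh_base _ _ _ _ _ _ _) Es)) as K. simpl in K.
    rewrite pairing_pr2 in K.
    pose proof (heq_eq Hs) as K'. simpl in K'.
    apply SimpleHom_eq; [exact K' |]. refine (eq_trans K _).
    exact (f_equal (comp (dial_hom_snd g)) (f_equal (fmap (simple_prod T)) Bt)). }
  split; [reflexivity |]. split.
  - rewrite <- Bs. exact (f_equal (@sh_fib _ _ _ _) (f_equal (@pbh_base _ _ _ _ _ _ _) Ek)).
  - exists i, j. split; [| split; [| split; [exact Ei | split; [exact Eij | exact Ej]]]].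
    + rewrite <- Bs. exact (heq_trans Hi (heq_sym (pbh_eq s))).
    + exact (heq_trans (heq_trans Hj (heq_sym (pbh_eq t)))
        (heq_of_eq (f_equal (fmap (simple_prod T)) Bt))).
Qed.

End DialHoms.

(** * Arrows of the iterated dual as spans *)

Section TowerHoms.

Variables (C E : Category) (T : FinProducts C) (P : Fibration E C).

Let Tower := Pb (sum_simple T P) (sum_S_proj T).
Let R : Fibration _ (Simple T) := fib_comp (Q2 T) (dual (Q3 T P)).

Definition tower_ob_base (o : DialOb T P) : SumCat T (simple_fib T) :=
  @Build_PbOb (Simple T) (Simple T) C (simple_fib T) (simple_prod T)
    (do_ctx o) (simple_prod T (do_ctx o), do_snd o) eq_refl.

Definition tower_ob_tot (o : DialOb T P) : SumCat T P :=
  @Build_PbOb E (Simple T) C P (simple_prod T)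
    (simple_prod T (do_ctx o), do_snd o) (do_fib o) (do_eq o).

Definition tower_ob (o : DialOb T P) : IteratedDual (Q3 T P) (Q2 T) :=
  @Build_PbOb _ _ _ (sum_simple T P) (sum_S_proj T)
    (tower_ob_base o) (tower_ob_tot o) eq_refl.

Definition tower_unob_eq (e : IteratedDual (Q3 T P) (Q2 T)) :
    prd T (simple_prod T (pb_base (pb_base e))) (snd (pb_base (pb_tot e)))
    = P (pb_tot (pb_tot e)) :=
  eq_trans
    (f_equal (fun A => prd T A _)
       (eq_trans (pb_ob_eq (pb_base e)) (f_equal fst (pb_ob_eq e))))
    (pb_ob_eq (pb_tot e)).

Definition tower_unob (e : IteratedDual (Q3 T P) (Q2 T)) : DialOb T P :=
  @Build_DialOb C E T P (pb_base (pb_base e)) (snd (pb_base (pb_tot e)))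
    (pb_tot (pb_tot e)) (tower_unob_eq e).

Lemma tower_unobK (e : IteratedDual (Q3 T P) (Q2 T)) :
  tower_ob (tower_unob e) = e.
Proof.
  destruct e as [[s t H] [[J Y] a K] M]. simpl in M. subst t.
  simpl in H. subst J. unfold tower_unob, tower_ob, tower_ob_tot, tower_ob_base;
  (* The equality proof is abstracted so that proof irrelevance can identify it with the given
     one. *)
  simpl. match goal with
  | |- context [tower_unob_eq ?x] => generalize (tower_unob_eq x)
  end.
  simpl. intro K'. now rewrite (proof_irrelevance _ K' K).
Qed.

Lemma tower_obK (o : DialOb T P) : tower_unob (tower_ob o) = o.
Proof.
  destruct o. unfold tower_unob; simpl. f_equal. apply proof_irrelevance.
Qed.

Section TowerSpan.

Variables (o o' : DialOb T P) (f : Hom (tower_ob o) (tower_ob o')).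

Definition tower_hom_fib :
    DualHom (Q3 T P) (pull R (tower_ob o') (dh_base f)) (tower_ob o) :=
  dh_fib f.

Definition tower_hom_snd_map :
    @Hom (Simple T) (simple_prod T (do_ctx o), do_snd o')
      (simple_prod T (do_ctx o), do_snd o) :=
  pbh_tot (dh_base tower_hom_fib).

Definition tower_hom_snd :
    Hom (prd T (simple_prod T (do_ctx o)) (do_snd o')) (do_snd o) :=
  sh_fib tower_hom_snd_map.

Definition tower_hom_mid : Tower :=
  pull (Q3 T P) (tower_ob o) (dh_base tower_hom_fib).

Definition tower_hom_left : @Hom Tower tower_hom_mid (tower_ob o) :=
  lift (Q3 T P) (tower_ob o) (dh_base tower_hom_fib).

Definition tower_hom_right : @Hom Tower tower_hom_mid (tower_ob o') :=
  lift (Q3 T P) (tower_ob o') (lift (Q2 T) (tower_ob_base o') (dh_base f))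
  ∘ dh_fib tower_hom_fib.

Definition tower_apex : Functor Tower E :=
  functor_comp (pb_proj_tot P (simple_prod T))
    (pb_proj_tot (sum_simple T P) (sum_S_proj T)).

(** The compatibility conditions of the two stacked pullbacks, composed. *)
Lemma tower_apex_over (a b : Tower) (h : Hom a b) :
  heq (fmap P (fmap tower_apex h))
    (fmap (simple_prod T) (fmap (sum_S_proj T) (fmap (Q3 T P) h))).
Proof.
  eapply heq_trans; [exact (heq_sym (pbh_eq (pbh_tot h))) |].
  apply heq_fmap. exact (heq_sym (pbh_eq h)).
Qed.

Lemma tower_hom_base :
  pbh_base (dh_base tower_hom_fib) = idc (do_ctx o).
Proof. exact (heq_eq (dh_vert f)). Qed.

(** Verticality over (I, X) in the outer dual passes through × to the compatibility condition of
    Sum(S) and makes the component on I × X an identity. *)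
Lemma tower_hom_snd_mapE : tower_hom_snd_map = fst_id tower_hom_snd.
Proof.
  apply SimpleHom_eq; [| reflexivity].
  pose proof (heq_eq (pbh_eq (dh_base tower_hom_fib))) as H.
  refine (eq_trans (eq_sym H) _). rewrite tower_hom_base.
  apply fmap_id.
Qed.

Lemma tower_hom_left_over :
  heq (fmap P (fmap tower_apex tower_hom_left))
    (fmap (simple_prod T) (fst_id tower_hom_snd)).
Proof.
  rewrite <- tower_hom_snd_mapE. apply tower_apex_over.
Qed.

Lemma tower_lift_snd (u : Hom (do_ctx o) (do_ctx o')) :
  fmap (sum_S_proj T) (lift (Q2 T) (tower_ob_base o') u)
  = snd_id T (do_snd o') (fmap (simple_prod T) u).
Proof.
  apply SimpleHom_eq; [| reflexivity]. apply comp_idl.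
Qed.

Lemma tower_hom_right_over :
  heq (fmap P (fmap tower_apex tower_hom_right)) (fmap (simple_prod T)
    (snd_id T (do_snd o') (fmap (simple_prod T) (dh_base f)))).
Proof.
  assert (H : heq (fmap (Q3 T P) tower_hom_right)
    (lift (Q2 T) (tower_ob_base o') (dh_base f))).
  { eapply over_vert_r; [apply dh_vert | apply lift_over]. }
  exact (heq_trans (tower_apex_over _) (heq_fmap (simple_prod T)
    (heq_trans (heq_fmap (sum_S_proj T) H)
      (heq_of_eq (tower_lift_snd (dh_base f)))))).
Qed.

(** Lifts of [Q3] are computed componentwise, so the component in E is itself a chosen lift of P. *)
Lemma tower_hom_cart : cartesian P (fmap tower_apex tower_hom_left).
Proof. apply lift_cart. Qed.

Definition tower_span : DialSpan o o' :=
  {| ds_ctx := dh_base f;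
     ds_snd := tower_hom_snd;
     ds_apex := tower_apex tower_hom_mid;
     ds_left := fmap tower_apex tower_hom_left;
     ds_right := fmap tower_apex tower_hom_right;
     ds_cart := tower_hom_cart;
     ds_left_over := tower_hom_left_over;
     ds_right_over := tower_hom_right_over |}.

End TowerSpan.

(** As for [dial_span_inj]; verticality also fixes the components of the innermost arrow in Sum(S)
    and S(C), leaving only its component in E to be read off the right leg. *)
Lemma tower_span_inj (o o' : DialOb T P)
    (f f' : Hom (tower_ob o) (tower_ob o')) :
  span_iso (tower_span f) (tower_span f') -> f = f'.
Proof.
  intros [Hm [Hg [i [Hi [Ei Fi]]]]].
  change (tower_hom_snd f = tower_hom_snd f') in Hg.
  pose proof (tower_hom_snd_mapE f) as K.
  rewrite Hg in K. rewrite <- (tower_hom_snd_mapE f') in K. clear Hg.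
  pose proof (eq_trans (tower_hom_base f) (eq_sym (tower_hom_base f'))) as B.
  destruct f as [m k Hk], f' as [m' k' Hk'].
  change (m = m') in Hm. subst m'.
  apply DualHom_eq; [reflexivity | apply heq_of_eq].
  change (pbh_base (dh_base k) = pbh_base (dh_base k')) in B.
  change (pbh_tot (dh_base k) = pbh_tot (dh_base k')) in K.
  pose proof (PbHom_eq B K) as W. clear B K.
  destruct k as [w x Hx], k' as [w' x' Hx']. simpl in W. subst w'.
  apply DualHom_eq; [reflexivity | apply heq_of_eq].
  change (heq (pbh_base x) (idc (Q3 T P (pull R (tower_ob o') m)))) in Hx.
  change (heq (pbh_base x') (idc (Q3 T P (pull R (tower_ob o') m)))) in Hx'.
  pose proof (heq_eq (heq_trans Hx (heq_sym Hx'))) as V.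
  apply PbHom_eq; [exact V |].
  assert (V' : pbh_base (pbh_tot x) = pbh_base (pbh_tot x')).
  { apply heq_eq. eapply heq_trans; [exact (heq_sym (pbh_eq x)) |].
    rewrite V. exact (pbh_eq x'). }
  apply PbHom_eq; [exact V' |].
  assert (Hi1 : i = idc _).
  { eapply hfactor_uniq; [apply lift_cart | exact Hi | now apply over_id |].
    rewrite comp_idr. exact Ei. }
  rewrite Hi1, comp_idr in Fi.
  eapply hfactor_uniq; [apply lift_cart | exact (heq_sym (pbh_eq (pbh_tot x)))
    | rewrite V'; exact (heq_sym (pbh_eq (pbh_tot x'))) | exact (eq_sym Fi)].
Qed.

Lemma tower_span_surj (o o' : DialOb T P) (s : DialSpan o o') :
  exists f, span_iso (tower_span f) s.
Proof.
  set (u := ds_ctx s).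
  set (p := pull R (tower_ob o') u : Tower).
  (* The arrow of Sum(S) over the identity of (I, X) whose other component is [fst_id (ds_snd s)];
     it is the base of the inner dual arrow. *)
  set (g := @Build_PbHom _ _ _ (simple_fib T) (simple_prod T)
    (Q3 T P p) (tower_ob_base o) (idc (do_ctx o)) (fst_id (ds_snd s))
    (heq_of_eq (fmap_id (simple_prod T) (do_ctx o)))).
  set (e := pull (Q3 T P) (tower_ob o) g : Tower).
  set (l := lift (Q3 T P) (tower_ob o) g).
  set (l' := lift (Q3 T P) (tower_ob o') (lift (Q2 T) (tower_ob_base o') u)).
  destruct (hfactor_ex (w := idc _) (ds_cart s) (ds_left_over s)
    (n := fmap tower_apex l)) as [i [Hi Ei]].
  { apply heq_id_r. apply tower_apex_over. }
  assert (Hl' : heq (fmap P (fmap tower_apex l')) (fmap (simple_prod T)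
    (snd_id T (do_snd o') (fmap (simple_prod T) u)))).
  { eapply heq_trans; [apply tower_apex_over |].
    apply heq_fmap, heq_of_eq, tower_lift_snd. }
  assert (Cl' : cartesian P (fmap tower_apex l')) by apply lift_cart.
  destruct (hfactor_ex (w := idc _) Cl' Hl' (n := ds_right s ∘ i))
    as [x [Hx Ex]].
  { apply heq_id_r. eapply over_vert_r; [exact Hi | apply ds_right_over]. }
  (* The factor x extended by identities in Sum(S) and S(C) to a vertical arrow of the tower. *)
  set (k := @Build_PbHom _ _ _ (sum_simple T P) (sum_S_proj T) e p
    (idc (Q3 T P p))
    (@Build_PbHom _ _ _ P (simple_prod T) (pb_tot e) (pb_tot p)
      (idc (sum_S_proj T (Q3 T P p)))
      x (heq_sym (heq_trans Hx (heq_of_eq (eq_sym (fmap_id _ _))))))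
    (heq_refl _)).
  exists (@Build_DualHom _ _ R (tower_ob o) (tower_ob o') u
    (@Build_DualHom _ _ (Q3 T P) p (tower_ob o) g k (heq_refl _)) (heq_refl _)).
  split; [reflexivity |]. split; [reflexivity |].
  exists i. split; [| split; [exact Ei | now symmetry]].
  eapply heq_trans; [exact Hi |]. apply heq_idc.
  exact (pb_ob_eq (pb_tot e)).
Qed.

(** Here [dual_dual_comp] applies to [Q3] directly, as the outer dual is taken of the composite of
    [Q2] with the dual of [Q3]; the resulting squares are then projected to E. *)
Lemma tower_span_comp (o1 o2 o3 : DialOb T P)
    (g : Hom (tower_ob o2) (tower_ob o3)) (f : Hom (tower_ob o1) (tower_ob o2)) :
  span_comp_rel (tower_span g) (tower_span f) (tower_span (g ∘ f)).
Proof.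
  destruct (dual_comp_spec (P := R) g f)
    as [_ [t [s [Ht [Et [Hs [Es Ek]]]]]]].
  destruct (dual_dual_comp Ek Et Es) as [i [j [Hi [Hj [Ei [Eij Ej]]]]]].
  pose proof (heq_eq Ht) as Ht1. pose proof (heq_eq Hs) as Hs1.
  assert (Bt : pbh_tot (dh_base t)
    = snd_id T (do_snd o3) (fmap (simple_prod T) (dh_base f))).
  { apply SimpleHom_eq.
    - refine (eq_trans (eq_sym (heq_eq (pbh_eq (dh_base t)))) _).
      exact (f_equal (fmap (simple_prod T)) Ht1).
    - pose proof (f_equal (@sh_fib _ _ _ _) (f_equal (@pbh_tot _ _ _ _ _ _ _)
        (f_equal (@dh_base _ _ _ _ _) Et))) as K. simpl in K.
      rewrite pairing_pr2 in K. exact K. }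
  assert (Bs : pbh_tot (dh_base s)
    = fst_id (comp_snd (tower_span g) (tower_span f))).
  { apply SimpleHom_eq.
    - refine (eq_trans (eq_sym (heq_eq (pbh_eq (dh_base s)))) _).
      refine (eq_trans (f_equal (fmap (simple_prod T)) Hs1) _).
      apply fmap_id.
    - pose proof (f_equal (@sh_fib _ _ _ _) (f_equal (@pbh_tot _ _ _ _ _ _ _)
        (f_equal (@dh_base _ _ _ _ _) Es))) as K. simpl in K.
      rewrite pairing_pr2 in K. refine (eq_trans K _).
      exact (f_equal (comp (tower_hom_snd g)) (f_equal (fmap (simple_prod T)) Bt)). }
  split; [reflexivity |]. split.
  - rewrite <- Bs.
    exact (f_equal (@sh_fib _ _ _ _) (f_equal (@pbh_tot _ _ _ _ _ _ _)
        (f_equal (@dh_base _ _ _ _ _) Ek))).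
  - exists (fmap tower_apex i), (fmap tower_apex j).
    split; [| split; [| split; [| split]]].
    + rewrite <- Bs. eapply heq_trans; [apply tower_apex_over |].
      exact (heq_fmap (simple_prod T) (heq_fmap (sum_S_proj T) Hi)).
    + eapply heq_trans; [apply tower_apex_over |].
      exact (heq_trans (heq_fmap (simple_prod T) (heq_fmap (sum_S_proj T) Hj))
        (heq_of_eq (f_equal (fmap (simple_prod T)) Bt))).
    + exact (f_equal (fmap tower_apex) Ei).
    + exact (f_equal (fmap tower_apex) Eij).
    + exact (f_equal (fmap tower_apex) Ej).
Qed.

End TowerHoms.

(** * The isomorphism of fibrations *)

Theorem mainTheorem4 (C E : Category) (T : FinProducts C) (P : Fibration E C) :
  fib_iso (Dial T P) (fib_comp (Q1 T) (iterated_dual (Q3 T P) (Q2 T))).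
Proof.
  apply fib_iso_of_rel with (mkL := @dial_ob C E T P)
    (mkR := @tower_ob C E T P) (unL := @dial_unob C E T P)
    (unR := @tower_unob C E T P)
    (rel := fun o o' f g => span_iso (dial_span f) (tower_span g)).
  - apply dial_unobK.
  - apply dial_obK.
  - apply tower_unobK.
  - apply tower_obK.
  - intros o o' f. destruct (tower_span_surj (dial_span f)) as [g Hg].
    exists g. split; [now apply span_iso_sym |].
    intros g' Hg'. apply tower_span_inj. now apply span_iso_trans with (dial_span f).
  - intros o o' g. destruct (dial_span_surj (tower_span g)) as [f Hf].
    exists f. split; [exact Hf |].
    intros f' Hf'. apply dial_span_inj.
    eapply span_iso_trans; [exact Hf | now apply span_iso_sym].
  - intros o1 o2 o3 f' f g' g H' H.
    eapply span_comp_rel_iso; [exact H' | exact H | |].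
    + apply dial_span_comp.
    + apply tower_span_comp.
  - intros o o' f g [H _].
    (* Isomorphic spans have equal components in S(C). The tower's projection to S(C) passes through
       [iterated_dual_map], which gives [dh_base g] only up to [heq]. *)
    apply (heq_fmap (simple_proj T)).
    eapply heq_trans; [exact (dual_map_base_heq _ g) |].
    apply heq_of_eq. now symmetry.
Qed.
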